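(* Let $M$ be a saturated nonstandard model of the superstructure $\mathcal{S}$ over $\mathbf{R}$, and fix a well-ordering $\prec$ of ${}^*\mathbf{R}={}^*\mathbf{R}_M$ of order type the cardinal $|{}^*\mathbf{R}|$. Then for every sequence $(c_i,\lambda_i)_{i<\alpha}$ with $c_i\in\mathbf{R}$ and $\lambda_i\in\Lambda=\Lambda_M$, where $\alpha<|{}^*\mathbf{R}|$ is an ordinal and $(\lambda_i)_{i<\alpha}$ is a decreasing sequence in $\Lambda$ (i.e. $\lambda_j<\lambda_i$ whenever $i<j<\alpha$), there exists an $x\in{}^*\mathbf{R}$ such that $(\lambda_i)_{i<\alpha}$ is the spectrum of $x$ and $f_x(\lambda_i)=c_i$ for all $i<\alpha$.
   Context: Models. Let $S_0=\mathbf{R}$ (treated as individuals), $S_{i+1}=S_i\cup\mathcal{P}(S_i)$ and $\mathcal{S}=\bigcup_{i}S_i$ (the superstructure). Consider bounded first-order formulas (every variable ranges over some entity, i.e. over some element of $\mathcal{S}\setminus S_0$) in the language with $=$, $\in$ and a constant for each element of $\mathcal{S}$. A nonstandard model $M$ of $\mathcal{S}$ is a structure containing $\mathcal{S}$ via an injection $x\mapsto{}^*x$, with relations extending $=$ and $\in$, in which exactly the bounded sentences true in $\mathcal{S}$ are true (transfer), and such that ${}^*\mathbf{R}$ is a proper extension of $\mathbf{R}$. A number $a\in{}^*\mathbf{R}$ is finite if $|a|<K$ for some $K\in\mathbf{R}$; its standard part $\operatorname{st}(a)\in\mathbf{R}$ is the unique real infinitely close to $a$. Saturation. A set $T$ of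 formulas $R(x,c)$ with one free variable $x$ and parameters $c$ is finitely satisfiable if for every finite subset of $T$ there is an $x\in M$ satisfying all formulas in this subset. $M$ is $\kappa$-saturated ($\kappa$ a cardinal) if for every finitely satisfiable $T$ with $|T|<\kappa$ there is an $x\in M$ satisfying all formulas of $T$. $M$ is saturated if it is $\kappa$-saturated for $\kappa$ equal to the cardinality of (the underlying set of) $M$. Decomposition. The well-ordering $\prec$ is given by a fixed bijection of ${}^*\mathbf{R}$ with the least ordinal of cardinality $|{}^*\mathbf{R}|$. For nonzero $x,y\in{}^*\mathbf{R}$ write $x\sim y$ if both $x/y$ and $y/x$ are finite. Let $\Lambda=({}^*\mathbf{R}\setminus\{0\})/{\sim}$, let $\lambda(x)$ be the class of $x$, and order $\Lambda$ by: $\lambda(x)<\lambda(y)$ iff $\lambda(x)\ne\lambda(y)$ and $|x|<|y|$. For $\lambda\in\Lambda$ let $a_\lambda$ be the $\prec$-minimal element of $\lambda$. For every $x\in{}^*\mathbf{R}$ define by transfinite recursion (simultaneously for all $x$): - $x_0=x$. - If $x_i=0$, the process stops and $\alpha(x):=i$. If $x_i\neq0$, put $\lambda_i=\lambda(x_i)$, $c_i=\operatorname{st}(x_i/a_{\lambda_i})$ and $x_{i+1}=x_i-c_ia_{\lambda_i}$. - If $\alpha$ is a limit ordinal and the process has not stopped before $\alpha$, put $x_\alpha=x-a$, where $a$ is the $\prec$-minimal element of the (nonempty) set of all $y\in{}^*\mathbf{R}$ whose process yields the same $(c_\beta,\lambda_\beta)$ for all $\beta<\alpha$. The classes $\lambda_i$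 produced by this process strictly decrease, so the process stops at some ordinal $\alpha(x)$. The spectrum of $x$ is the sequence $(\lambda_i)_{i<\alpha(x)}$, and $f_x:\Lambda\to\mathbf{R}$ is defined by $f_x(\lambda_i)=c_i$ for $i<\alpha(x)$ and $f_x(\lambda)=0$ for $\lambda$ not in the spectrum.
   Formalization: The formal theorem additionally assumes that every c_i is nonzero; this is necessary, since each coefficient produced by the process is the standard part of x_i/a_{λ_i} with x_i ~ a_{λ_i}, hence nonzero, so the claim fails whenever some c_i = 0 (e.g. α = 1, c_0 = 0). *)

(* Defs.v *)
From HB Require Import structures.
From mathcomp Require Import all_boot all_order all_algebra.
From mathcomp Require Import boolp classical_sets functions cardinality wochoice.
From mathcomp Require Import reals.

Set Implicit Arguments.
Unset Strict Implicit.
Unset Printing Implicit Defensive.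

Import Order.TTheory GRing.Theory Num.Theory.
Local Open Scope classical_set_scope.
Local Open Scope card_scope.
Local Open Scope ring_scope.

Section Superstructure.
Variable T : Type.

(* A copy of S_n. Since S_(n+1) = S_n `|` P(S_n) = S_0 `|` P(S_n), an element
   of S_(n+1) is either an individual or a set of elements of S_n. *)
Fixpoint lev (n : nat) : Type :=
  if n is m.+1 then (T + set (lev m))%type else T.

Fixpoint up (n : nat) : lev n -> lev n.+1 :=
  match n with
  | 0 => fun r => inl r
  | m.+1 => fun v => match v with
                     | inl r => inl r
                     | inr A => inr (@up m @` A)
                     end
  end.

Definition Up (u : {n & lev n}) : {n & lev n} :=
  existT lev (projT1 u).+1 (up (projT2 u)).

(* The union of the S_n. Every element is represented once, at the least level
   at which it occurs, so that Leibniz equality is equality of elements. *)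
Definition super := {u : {n & lev n} | forall v, Up v <> u}.

HB.instance Definition _ := gen_eqMixin super.
HB.instance Definition _ := gen_choiceMixin super.

Definition rank (u : super) : nat := projT1 (sval u).

Definition superlev (n : nat) : set super := [set u | (rank u <= n)%N].

Definition smem (u w : super) : Prop :=
  exists (n : nat) (A : set (lev n)) (a : lev n) (k : nat),
    [/\ sval w = existT lev n.+1 (inr A), A a
      & iter k Up (sval u) = existT lev n a].

Lemma ind_subproof (r : T) (v : {n & lev n}) : Up v <> existT lev 0 r.
Proof. by move=> /(congr1 (@projT1 _ _)). Qed.

Definition ind (r : T) : super := exist _ _ (@ind_subproof r).

Definition entity (w : super) : Prop := forall r, w <> ind r.

Lemma sempty_subproof (v : {n & lev n}) :
  Up v <> existT lev 1 (inr set0 : lev 1).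
Proof.
case: v => -[|n] v e; last by have := congr1 (@projT1 _ _) e.
exact: (notF (congr1 (fun z : lev 1 => if z is inl _ then false else true) (eq_from_Tagged e))).
Qed.

Definition sempty : super := exist _ _ sempty_subproof.

(* The entity with set of members P; meaningful when P is included in some S_n
   (lemma [mem_sset]). *)
Definition sset (P : set super) : super :=
  xget sempty [set w | entity w /\ forall u, smem u w <-> P u].

Definition slev (n : nat) : super := sset (superlev n).

Definition spair (a b : super) : super :=
  sset [set sset [set a]; sset [set a; b]].

Definition srel (r : T -> T -> Prop) : super :=
  sset [set p | exists x y, r x y /\ p = spair (ind x) (ind y)].

Definition sgraph (f : T -> T -> T) : super :=
  sset [set p | exists x y, p = spair (spair (ind x) (ind y)) (ind (f x y))].

End Superstructure.

Section SuperstructureTheory.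
Variable T : Type.
Implicit Types u v w : super T.
Local Notation lev := (lev T).

Lemma existT_inj n (a b : lev n) : existT lev n a = existT lev n b -> a = b.
Proof. exact: eq_from_Tagged. Qed.

Lemma up_inj n : injective (@up T n).
Proof.
elim: n => [|n IH] /=; first by move=> a b [].
move=> [r|A] [s|B] //; first by move=> [->].
case=> e; congr inr; apply/seteqP; split=> x Hx.
  have : (@up T n @` A) (up x) by exists x.
  by rewrite e => -[y By /IH <-].
have : (@up T n @` B) (up x) by exists x.
by rewrite -e => -[y By /IH <-].
Qed.

Lemma Up_inj : injective (@Up T).
Proof.
move=> [n a] [m b] e; have /= [nm] := congr1 (@projT1 _ _) e.
by subst m; have /= /up_inj -> := existT_inj e.
Qed.

Lemma iter_Up_rank k (u : {n & lev n}) :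
  projT1 (iter k (@Up T) u) = (k + projT1 u)%N.
Proof. by elim: k => //= k ->. Qed.

Lemma super_rep n (a : lev n) :
  exists u k, iter k (@Up T) (sval u) = existT lev n a.
Proof.
elim: n a => [|n IH] a; first by exists (ind a), 0%N.
have [[z e]|h] := pselect (exists z, Up z = existT lev n.+1 a); last first.
  by exists (exist _ (existT lev n.+1 a) (fun z e => h (ex_intro _ z e))), 0%N.
case: z e => m b e; have /= [mn] := congr1 (@projT1 _ _) e; subst m.
by have [u [k ek]] := IH b; exists u, k.+1; rewrite /= ek.
Qed.

Lemma super_rep_uniq k l u v :
  iter k (@Up T) (sval u) = iter l (@Up T) (sval v) -> u = v.
Proof.
elim: k l => [|k IH] [|l] /= e.
- by case: u v e => [u hu] [v hv] /= e; subst v; congr exist; apply: Prop_irrelevance.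
- by case: (svalP u (iter l (@Up T) (sval v))).
- by case: (svalP v (iter k (@Up T) (sval u))).
- exact/(IH l)/Up_inj.
Qed.

Lemma smem_ind u r : ~ smem u (ind r).
Proof. by move=> [n [A [a [k [/(congr1 (@projT1 _ _))]]]]]. Qed.

Lemma smem_rank u w : smem u w -> (rank u < rank w)%N.
Proof.
move=> [n [A [a [k [e _ /(congr1 (@projT1 _ _))]]]]].
rewrite iter_Up_rank /= => nE; rewrite /rank e /= ltnS -nE; exact: leq_addl.
Qed.

Lemma entity_rep w : entity w ->
  exists n (A : set (lev n)), sval w = existT lev n.+1 (inr A).
Proof.
case: w => [[[|n] a] h] ent.
  by case: (ent a); congr exist; apply: Prop_irrelevance.
case: a h ent => [r|A] h ent; last by exists n, A.
exfalso; case: n h {ent} => [|n] h.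
  exact: (h (existT lev 0 r)).
exact: (h (existT lev n.+1 (inl r))).
Qed.

Lemma smemE u w n (A : set (lev n)) a k : sval w = existT lev n.+1 (inr A) ->
  iter k (@Up T) (sval u) = existT lev n a -> smem u w <-> A a.
Proof.
move=> ew ea; split=> [|Aa]; last by exists n, A, a, k.
move=> [m [B [b [l [ew' Bb eb]]]]].
have /= [mn] := congr1 (@projT1 _ _) (etrans (esym ew) ew'); subst m.
have [BA] := existT_inj (etrans (esym ew) ew'); rewrite BA.
suff <- : b = a by [].
apply: existT_inj; rewrite -ea -eb.
have := congr1 (@projT1 _ _) ea; have := congr1 (@projT1 _ _) eb.
rewrite !iter_Up_rank /= => h1 h2; congr iter.
by apply/eqP; rewrite -(eqn_add2r (projT1 (sval u))) h1 h2.
Qed.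

Lemma super_ext_le w w' : entity w -> entity w' -> (rank w <= rank w')%N ->
  (forall u, smem u w <-> smem u w') -> w = w'.
Proof.
move=> /entity_rep[n [A eA]] /entity_rep[m [B eB]].
rewrite /rank eA eB /= ltnS leq_eqVlt => /predU1P[nm|nm] eq.
  subst m; apply: (@super_rep_uniq 0 0); rewrite /= eA eB; suff -> : A = B by [].
  apply/seteqP; split=> a; have [u [k ek]] := super_rep a.
    by move=> /(smemE eA ek)/eq/(smemE eB ek).
  by move=> /(smemE eB ek)/eq/(smemE eA ek).
case: m nm B eB => // m nm B eB; exfalso.
apply: (svalP w' (existT lev m.+1 (inr (@up T m @^-1` B)))).
rewrite eB /Up /=; suff -> : @up T m @` (@up T m @^-1` B) = B by [].
apply/seteqP; split=> [b [c Bc <-]//|b Bb].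
have [u [k ek]] := super_rep b.
have /smem_rank := (eq u).2 ((smemE eB ek).2 Bb).
rewrite /rank eA /= ltnS => un.
have um := leq_trans un nm.
have [c ec] : exists c : lev m, iter (m - rank u) (@Up T) (sval u) = existT lev m c.
  case: (iter _ _ _) (iter_Up_rank (m - rank u) (sval u)) => m' c /=.
  by rewrite subnK // => mm; subst m'; exists c.
have kE : k = (m - rank u).+1.
  have := congr1 (@projT1 _ _) ek; rewrite iter_Up_rank /= => kE.
  by rewrite -subSn // -kE addnK.
have : existT lev m.+1 (up c) = existT lev m.+1 b.
  by rewrite -ek kE /= ec.
move=> /existT_inj ub; exists c => //=.
by rewrite /preimage /= ub.
Qed.

Lemma super_ext w w' : entity w -> entity w' ->
  (forall u, smem u w <-> smem u w') -> w = w'.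
Proof.
move=> ew ew' h; have [le|/ltnW le] := leqP (rank w) (rank w').
  exact: super_ext_le.
by apply/esym/super_ext_le => // u; split=> /h.
Qed.

Lemma entityP (w : super T) n (A : set (lev n)) :
  sval w = existT lev n.+1 (inr A) -> entity w.
Proof. by move=> e r wr; have := congr1 (@projT1 _ _) e; rewrite wr. Qed.

Definition lev_trace n (P : set (super T)) : set (lev n) :=
  [set a | exists u k, P u /\ iter k (@Up T) (sval u) = existT lev n a].

Lemma lev_traceP n (P : set (super T)) w : P `<=` @superlev T n ->
  sval w = existT lev n.+1 (inr (@lev_trace n P)) ->
  [/\ entity w, (rank w <= n.+1)%N & forall u, smem u w <-> P u].
Proof.
move=> Pn ew; split; [exact: entityP ew|by rewrite /rank ew|move=> u].
split=> [[m [B [b [k [ew']]]]]|Pu].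
  have /= [mn] := congr1 (@projT1 _ _) (etrans (esym ew) ew'); subst m.
  have [<-] := existT_inj (etrans (esym ew) ew').
  move=> [v [l [Pv ev]]] eu.
  by have -> := super_rep_uniq (etrans eu (esym ev)).
have [a ea] : exists a : lev n,
    iter (n - rank u) (@Up T) (sval u) = existT lev n a.
  case: (iter _ _ _) (iter_Up_rank (n - rank u) (sval u)) => m' c /=.
  by rewrite subnK; [move=> mm; subst m'; exists c|exact: Pn].
by exists n, (@lev_trace n P), a, (n - rank u)%N; split=> //; exists u, (n - rank u)%N.
Qed.

Lemma super_comprehension n (P : set (super T)) : P `<=` @superlev T n ->
  exists w, [/\ entity w, (rank w <= n.+1)%N & forall u, smem u w <-> P u].
Proof.
elim: n => [|n IH] Pn.
  have h z : Up z <> existT lev 1 (inr (@lev_trace 0 P)).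
    case: z => -[|m] z e; last by have := congr1 (@projT1 _ _) e.
    by have := existT_inj e.
  by exists (exist _ _ h); exact: lev_traceP.
have [/IH[w [ew rw mw]]|nP] := pselect (P `<=` @superlev T n).
  by exists w; split=> //; exact: leqW.
suff h z : Up z <> existT lev n.+2 (inr (@lev_trace n.+1 P)).
  by exists (exist _ _ h); exact: lev_traceP.
move=> e; apply: nP => u Pu; rewrite /superlev /= leqNgt; apply/negP => nu.
have ru : rank u = n.+1 by apply/eqP; rewrite eqn_leq nu Pn.
case: z e => m z e; have /= [mn] := congr1 (@projT1 _ _) e; subst m.
case: z e => [r|B] e; first by have /= := existT_inj e.
have /= [eB] := existT_inj e.
case: u Pu nu ru => -[k a] hu Pu _; rewrite /rank /= => kn; subst k.
have : lev_trace P a by exists (exist _ (existT lev n.+1 a) hu), 0%N.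
by rewrite -eB => -[b Bb ba]; apply: (hu (existT lev n b)); rewrite /Up /= ba.
Qed.

Lemma mem_sset n (P : set (super T)) : P `<=` @superlev T n ->
  forall u, smem u (sset P) <-> P u.
Proof.
move=> /super_comprehension[w [ew _ mw]].
rewrite /sset; case: xgetP => [v _ [] //|/(_ w) h].
by case: h.
Qed.

Lemma sset_entity (P : set (super T)) : entity (sset P).
Proof.
rewrite /sset; case: xgetP => [v _ [] //|_ r].
by move=> /(congr1 (@rank T)).
Qed.

Lemma rank_sset n (P : set (super T)) :
  P `<=` @superlev T n -> (rank (sset P) <= n.+1)%N.
Proof.
move=> Pn; have [w [ew rw mw]] := super_comprehension Pn.
suff -> : sset P = w by [].
apply: super_ext => //; first exact: sset_entity.
by move=> u; rewrite (mem_sset Pn) mw.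
Qed.

Lemma mem_slev n u : smem u (slev T n) <-> (rank u <= n)%N.
Proof. exact: (@mem_sset n). Qed.

Lemma superlev0 : @superlev T 0 = range (@ind T).
Proof.
apply/seteqP; split=> [u|_ [r _ <-]] //.
case: u => -[[|n] a] h; rewrite /superlev /rank //= => _.
by exists a => //; congr exist; apply: Prop_irrelevance.
Qed.

Lemma superlevS n : @superlev T n.+1 =
  @superlev T n `|` [set w | entity w /\ [set u | smem u w] `<=` @superlev T n].
Proof.
apply/seteqP; split=> w.
  move=> wn; have [[r ->]|ew] := pselect (exists r, w = ind r); first by left.
  right; split=> [r wr|u /smem_rank]; first by apply: ew; exists r.
  by move=> /leq_trans/(_ wn).
move=> [/leqW //|[ew wn]].
have -> : w = sset [set u | smem u w].
  apply: super_ext => //; first exact: sset_entity.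
  by move=> u; rewrite (mem_sset wn).
exact: rank_sset.
Qed.

End SuperstructureTheory.

(* Bounded formulas over individuals [T], with constants in [C] and free
   variables in [V]; a quantifier binds the variable [None] of its body, which
   ranges over an entity. *)
Inductive term (C V : Type) := Var of V | Cst of C.

Inductive formula (T C V : Type) : Type :=
  | FEq of term C V & term C V
  | FIn of term C V & term C V
  | FNot of formula T C V
  | FAnd of formula T C V & formula T C V
  | FOr of formula T C V & formula T C V
  | FImp of formula T C V & formula T C V
  | FAll of {A : super T | entity A} & formula T C (option V)
  | FEx of {A : super T | entity A} & formula T C (option V).

Section Satisfaction.
(* [mem] interprets the membership symbol, [bnd] the entities bounding the
   quantifiers and [cst] the constants. *)
Variables (T C U : Type) (mem : U -> U -> Prop) (bnd : super T -> U) (cst : C -> U).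

Definition eval V (env : V -> U) (t : term C V) : U :=
  match t with Var v => env v | Cst c => cst c end.

Definition extend_env V (env : V -> U) (x : U) (o : option V) : U :=
  if o is Some v then env v else x.

Fixpoint sat V (env : V -> U) (f : formula T C V) : Prop :=
  match f with
  | FEq s t => eval env s = eval env t
  | FIn s t => mem (eval env s) (eval env t)
  | FNot g => ~ sat env g
  | FAnd g h => sat env g /\ sat env h
  | FOr g h => sat env g \/ sat env h
  | FImp g h => sat env g -> sat env h
  | FAll A g => forall x, mem x (bnd (sval A)) -> sat (extend_env env x) g
  | FEx A g => exists2 x, mem x (bnd (sval A)) & sat (extend_env env x) g
  end.

End Satisfaction.

Definition no_var (U : Type) (v : void) : U := match v with end.

Record nonstandard_model (T : Type) := NonstandardModel {
  dom :> Type;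
  nsmem : dom -> dom -> Prop;
  star : super T -> dom;
  star_inj : injective star;
  star_smem : forall u v, nsmem (star u) (star v) <-> smem u v;
  transfer : forall f : formula T (super T) void,
    sat nsmem star star (@no_var dom) f <->
    sat (@smem T) id id (@no_var (super T)) f;
  star_proper : exists x,
    nsmem x (star (slev T 0)) /\ forall r, x <> star (ind r)
}.

Definition card_lt A B (X : set A) (Y : set B) : Prop :=
  (X #<= Y) /\ ~ (Y #<= X).

Section Saturation.
Variables (T : Type) (M : nonstandard_model T).

(* Formulas with parameters: the constants are the elements of [M], and the only
   free variable is [tt : unit]. It ranges over all of [M]. *)
Definition holds_at (x : M) (f : formula T M unit) : Prop :=
  sat (@nsmem T M) (@star T M) id (fun=> x) f.

Definition finitely_satisfiable (F : set (formula T M unit)) : Prop :=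
  forall G, G `<=` F -> finite_set G -> exists x, forall f, G f -> holds_at x f.

(* [kappa] is given by a type of that cardinality. *)
Definition kappa_saturated (kappa : Type) : Prop :=
  forall F, card_lt F [set: kappa] -> finitely_satisfiable F ->
  exists x, forall f, F f -> holds_at x f.

Definition saturated : Prop := kappa_saturated M.

End Saturation.

Section Hyperreal.
Variables (R : realType) (M : nonstandard_model R).
Local Notation "x '\inM' y" := (nsmem x y) (at level 70).

Definition hreal := {x : M | x \inM star M (slev R 0)}.

HB.instance Definition _ := gen_eqMixin hreal.
HB.instance Definition _ := gen_choiceMixin hreal.

Implicit Types x y z a : hreal.

Lemma hinj_subproof (r : R) : star M (ind r) \inM star M (slev R 0).
Proof. exact/star_smem/mem_slev. Qed.

Definition hinj (r : R) : hreal :=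
  exist (fun x : M => x \inM star M (slev R 0)) _ (hinj_subproof r).

(* Pairs of elements [a] and [b] of star S_n, in the sense of [M]. The
   quantifiers are bounded, so that transfer applies. *)
Definition is_upair (n : nat) (d a b : M) : Prop :=
  d \inM star M (slev R n.+1) /\
  forall u, u \inM star M (slev R n) -> (u \inM d <-> u = a \/ u = b).

Definition is_pair (n : nat) (p a b : M) : Prop :=
  exists s d, [/\ is_upair n s a a, is_upair n d a b & is_upair n.+1 p s d].

Definition hrel (r : R -> R -> Prop) x y : Prop :=
  exists p, is_pair 0 p (sval x) (sval y) /\ p \inM star M (srel r).

Definition hop (f : R -> R -> R) x y : hreal :=
  xget (hinj 0) [set z | exists p q,
    [/\ is_pair 0 p (sval x) (sval y), is_pair 2 q p (sval z)
      & q \inM star M (sgraph f)]].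

Definition hlt := hrel (fun r s => r < s).
Definition hsub := hop (fun r s => r - s).
Definition hmul := hop (fun r s => r * s).
Definition hdiv := hop (fun r s => r / s).
Definition habs x : hreal :=
  if `[< hlt x (hinj 0) >] then hsub (hinj 0) x else x.

Definition hfinite x : Prop := exists K : R, hlt (habs x) (hinj K).

Definition inf_close x y : Prop :=
  forall e : R, 0 < e -> hlt (habs (hsub x y)) (hinj e).

Definition st x : R := xget 0 [set r | inf_close x (hinj r)].

Definition hsim x y : Prop := hfinite (hdiv x y) /\ hfinite (hdiv y x).

(* Meaningful for nonzero [x] only. *)
Definition cls x : set hreal := [set y | y <> hinj 0 /\ hsim x y].

Definition Lambda := {l : set hreal | exists2 x, x <> hinj 0 & l = cls x}.

Definition Lambda_lt (l l' : Lambda) : Prop :=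
  l <> l' /\ exists x y, [/\ x <> hinj 0, y <> hinj 0, sval l = cls x,
    sval l' = cls y & hlt (habs x) (habs y)].

End Hyperreal.

Record wotype := WOType {
  wosort :> Type;
  wole : rel wosort;
  wole_wo : well_order wole
}.

Definition wolt (I : wotype) (i j : I) : Prop := wole i j /\ i <> j.

Lemma wolt_wf (I : wotype) : well_founded (@wolt I).
Proof.
move=> i; apply: contrapT => nAi.
have [j [[Aj minj] _]] := @wole_wo I (fun k => `[< ~ Acc (@wolt I) k >])
  (ex_intro _ i (introT (asboolP _) nAi)).
apply: (asboolP _ Aj); split=> k [kj nkj]; apply: contrapT => nAk.
have jk := minj k (introT (asboolP _) nAk).
have [m [_ um]] := @wole_wo I (fun l => `[< l = j \/ l = k >])
  (ex_intro _ j (introT (asboolP _) (or_introl erefl))).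
have rfl (l : I) : wole l l.
  have [n [[/asboolP -> h] _]] := @wole_wo I (fun n => `[< n = l >])
    (ex_intro _ l (introT (asboolP _) erefl)).
  exact/h/asboolP.
have mk : m = k by apply: um; split=> [|l /asboolP[->|->]] //; apply/asboolP; right.
have mj : m = j by apply: um; split=> [|l /asboolP[->|->]] //; apply/asboolP; left.
by apply: nkj; rewrite -mk.
Qed.

(* The order type of the well-order [le] on [A] is a cardinal: no smaller
   ordinal, i.e. no proper initial segment, has the cardinality of [A]. *)
Definition initial_order (A : Type) (le : rel A) : Prop :=
  forall a, ~ ([set b | le b a /\ b <> a] #= [set: A]).

Section Decomposition.
Variables (R : realType) (M : nonstandard_model R) (prec : rel (hreal M)).
Implicit Types x y a : hreal M.
Local Notation h0 := (hinj M 0).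

Definition prec_min (A : set (hreal M)) : hreal M :=
  xget h0 [set a | A a /\ forall y, A y -> prec a y].

Definition coef x : R := st (hdiv x (prec_min (cls x))).

Definition next_state x : hreal M :=
  hsub x (hmul (hinj M (coef x)) (prec_min (cls x))).

Section Process.
Variable I : wotype.

(* A state [h i x] is [Some x_i], or [None] if the process has stopped before
   [i]. *)
Definition history := I -> hreal M -> option (hreal M).

Definition running (D : set I) (h : history) x : Prop :=
  forall i, D i -> exists2 y, h i x = Some y & y <> h0.

Definition is_last (D : set I) (i : I) : Prop :=
  D i /\ forall j, D j -> wole j i.

(* The processes of [x] and [y] are running and yield the same coefficients
   and classes at all [i] in [D]. *)
Definition same_data (D : set I) (h : history) x y : Prop :=
  forall i, D i -> exists u v,
    [/\ h i x = Some u /\ u <> h0, h i y = Some v /\ v <> h0,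
        coef u = coef v & cls u = cls v].

(* The state of the process of [x] at the ordinal which is the order type of
   the initial segment [D], given the states [h] at all earlier ordinals. *)
Definition state_after (D : set I) (h : history) x : option (hreal M) :=
  if pselect (running D h x) isn't left _ then None
  else if pselect (D = set0) is left _ then Some x
  else if pselect (exists i, is_last D i) is left e then
    omap next_state (h (projT1 (cid e)) x)
  else Some (hsub x (prec_min [set y | same_data D h x y])).

Definition before (i : I) : set I := [set j | wolt j i].

Definition state : history :=
  Fix (@wolt_wf I) (fun=> hreal M -> option (hreal M))
    (fun i rec => state_after (before i)
       (fun j => if pselect (wolt j i) is left ji then rec j ji else fun=> None)).

Lemma eq_state_after (D : set I) (h h' : history) :
  (forall i, D i -> h i = h' i) -> state_after D h = state_after D h'.
Proof.
move=> hh'; apply/funext => x; rewrite /state_after.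
have -> : running D h = running D h'.
  apply/funext => y; apply/propext.
  by split=> r i Di; have := r i Di; rewrite hh'.
have -> : same_data D h = same_data D h'.
  apply/funext => y; apply/funext => z; apply/propext.
  by split=> r i Di; have := r i Di; rewrite hh'.
case: pselect => // _; case: pselect => // _; case: pselect => // e.
by rewrite hh' //; case: (projT2 (cid e)).
Qed.

Lemma stateE (i : I) : state i = state_after (before i) state.
Proof.
rewrite {1}/state Fix_eq.
  apply: eq_state_after => j ji; case: pselect => [ji'|/(_ ji)//].
  by rewrite /state.
move=> j f g fg; apply: eq_state_after => k kj.
by case: pselect => // kj'; rewrite fg.
Qed.

(* The process of [x] stops exactly at the order type of [I]. *)
Definition stops_at x : Prop := state_after setT state x = Some h0.

Definition is_spectrum x (l : I -> Lambda M) : Prop :=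
  stops_at x /\ forall i, exists2 y, state i x = Some y & cls y = sval (l i).

End Process.

(* The function f_x; if [l] is not in the spectrum of [x] then the set below is
   empty and the value is 0. *)
Definition spectral_fun x (l : Lambda M) : R :=
  xget 0 [set c | exists (I : wotype) (i : I) y,
    [/\ state i x = Some y, y <> h0, cls y = sval l & coef y = c]].

End Decomposition.

(* Main.v *)
(** Let b_i denote the partial sum of the terms c_j a_{lambda_j} with j < i: at a
    successor a term is added, and at a limit b_i is the element which the
    process itself selects. Then x yields the prescribed data below i exactly
    when x - b_j - c_j a_{lambda_j} is infinitesimal relative to a_{lambda_j} for
    all j < i, and in that case x_i = x - b_i. Hence the partial sum at the order
    type of the whole sequence is the required x. The only issue is the
    existence, at a limit, of an element with the prescribed data. It follows
    from saturation applied to the inequalities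
    |x - b_j| < (|c_j| + 1) |a_{lambda_j}|, one for each j < i: finitely many of
    them are satisfied by b_m + c_m a_{lambda_m}, with m the largest index
    involved, and all of them together force the infinitesimal conditions, since
    the inequality of a later index k gives |x - b_k| << |a_{lambda_j}|. *)

Require Import Defs.
From mathcomp Require Import all_boot all_order all_algebra.
From mathcomp Require Import boolp classical_sets functions cardinality wochoice.
From mathcomp Require Import reals.
From HB Require Import structures.
From mathcomp Require Import ring lra.

Set Implicit Arguments.
Unset Strict Implicit.
Unset Printing Implicit Defensive.

Import Order.TTheory GRing.Theory Num.Theory.
Local Open Scope classical_set_scope.
Local Open Scope card_scope.
Local Open Scope ring_scope.

(** * Pairs, relations and graphs inside the superstructure *)

Section KuratowskiPairs.
Variable T : Type.

(* Generalize [is_upair] and [is_pair] to any interpretation of membership and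
   constants, so that they can be read both in [M] and in the superstructure. *)
Section Reading.
Variables (U : Type) (mem : U -> U -> Prop) (bnd : super T -> U).

Definition upair_in (n : nat) (d a b : U) : Prop :=
  mem d (bnd (slev T n.+1)) /\
  forall u, mem u (bnd (slev T n)) -> (mem u d <-> u = a \/ u = b).

Definition pair_in (n : nat) (p a b : U) : Prop :=
  exists s d, [/\ upair_in n s a a, upair_in n d a b & upair_in n.+1 p s d].

Definition rel_in (r : T -> T -> Prop) (x y : U) : Prop :=
  exists p, pair_in 0 p x y /\ mem p (bnd (srel r)).

Definition op_in (f : T -> T -> T) (x y z : U) : Prop :=
  exists p q, [/\ pair_in 0 p x y, pair_in 2 q p z & mem q (bnd (sgraph f))].

End Reading.

Lemma upair_superlev n (a b : super T) : (rank a <= n)%N -> (rank b <= n)%N ->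
  [set a; b] `<=` @superlev T n.
Proof. by move=> ra rb _ [->|->]. Qed.

(** The first clause bounds the rank of [d] by [n.+1], so its members have rank at most [n] and
    testing membership over S_n alone determines [d]. As [a] is a member, [d] is not an individual
    and extensionality applies. *)
Lemma upair_superP n (d a b : super T) : (rank a <= n)%N -> (rank b <= n)%N ->
  upair_in (@smem T) id n d a b <-> d = sset [set a; b].
Proof.
move=> ra rb; have sab := upair_superlev ra rb; split=> [[/mem_slev rd dP]|->].
  have ad : smem a d by apply/dP; [exact/mem_slev|left].
  apply: super_ext => [r dr||u].
  - by rewrite dr in ad; exact: smem_ind ad.
  - exact: sset_entity.
  rewrite (mem_sset sab); split=> [ud|/= uab].
    have ru : (rank u <= n)%N by rewrite -ltnS (leq_trans (smem_rank ud)).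
    by apply/(dP u (proj2 (mem_slev n u) ru)).
  have ru : (rank u <= n)%N by case: uab => ->.
  by apply/(dP u (proj2 (mem_slev n u) ru)).
split; first by apply/mem_slev; exact: rank_sset sab.
by move=> u _; rewrite (mem_sset sab).
Qed.

Lemma rank_supair n (a b : super T) : (rank a <= n)%N -> (rank b <= n)%N ->
  (rank (sset [set a; b]) <= n.+1)%N.
Proof. by move=> ra rb; apply: rank_sset; exact: upair_superlev. Qed.

Lemma spairE (a b : super T) : spair a b = sset [set sset [set a; a]; sset [set a; b]].
Proof. by rewrite /spair setUid. Qed.

Lemma pair_superP n (p a b : super T) : (rank a <= n)%N -> (rank b <= n)%N ->
  pair_in (@smem T) id n p a b <-> p = spair a b.
Proof.
move=> ra rb; rewrite spairE; split=> [[s [d [sa dab]]]|->].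
  move/(upair_superP _ ra ra) : sa => ->; move/(upair_superP _ ra rb) : dab => ->.
  by move/upair_superP; apply; exact: rank_supair.
exists (sset [set a; a]), (sset [set a; b]).
by split; apply/upair_superP => //; exact: rank_supair.
Qed.

Lemma rank_spair n (a b : super T) : (rank a <= n)%N -> (rank b <= n)%N ->
  (rank (spair a b) <= n.+2)%N.
Proof. by move=> ra rb; rewrite spairE !rank_supair. Qed.

Lemma supair_inj n (a b a' b' : super T) : (rank a <= n)%N -> (rank b <= n)%N ->
  (rank a' <= n)%N -> (rank b' <= n)%N ->
  sset [set a; b] = sset [set a'; b'] -> [set a; b] = [set a'; b'].
Proof.
move=> ra rb ra' rb' e; apply/seteqP.
have s := mem_sset (upair_superlev ra rb); have s' := mem_sset (upair_superlev ra' rb').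
by split=> u; rewrite -s -s' e.
Qed.

Lemma set2_inj (X : Type) (a b b' : X) : [set a; b] = [set a; b'] -> b = b'.
Proof.
move=> e; have : [set a; b'] b by rewrite -e; right.
have : [set a; b] b' by rewrite e; right.
by move=> [->|->] // [].
Qed.

Lemma spair_inj n (a b a' b' : super T) : (rank a <= n)%N -> (rank b <= n)%N ->
  (rank a' <= n)%N -> (rank b' <= n)%N ->
  spair a b = spair a' b' -> a = a' /\ b = b'.
Proof.
move=> ra rb ra' rb'; rewrite !spairE.
move/(supair_inj (rank_supair ra ra) (rank_supair ra rb)
  (rank_supair ra' ra') (rank_supair ra' rb')) => e.
have aa' : a = a'.
  have [] : [set sset [set a'; a']; sset [set a'; b']] (sset [set a; a]).
  - by rewrite -e; left.
  - move=> /(supair_inj ra ra ra' ra') h.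
    have : [set a'; a'] a by rewrite -h; left.
    by case.
  - move=> /(supair_inj ra ra ra' rb') h.
    have : [set a; a] a' by rewrite h; left.
    by case.
split=> //; subst a'.
by apply: (@set2_inj _ a); apply: (supair_inj ra rb ra rb'); exact: set2_inj e.
Qed.

Lemma ind_inj : injective (@ind T).
Proof. by move=> r s /(congr1 (@sval _ _)) /existT_inj. Qed.

Lemma srel_superlev (r : T -> T -> Prop) :
  [set p | exists x y, r x y /\ p = spair (ind x) (ind y)] `<=` @superlev T 2.
Proof. by move=> p [x [y [_ ->]]]; exact: (@rank_spair 0). Qed.

Lemma sgraph_superlev (f : T -> T -> T) :
  [set p | exists x y, p = spair (spair (ind x) (ind y)) (ind (f x y))]
    `<=` @superlev T 4.
Proof.
by move=> p [x [y ->]]; apply: (@rank_spair 2) => //; exact: (@rank_spair 0).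
Qed.

Lemma rel_superP r (x y : T) :
  rel_in (@smem T) id r (ind x) (ind y) <-> r x y.
Proof.
split=> [[p [/pair_superP -> //]]|rxy].
  move/(mem_sset (@srel_superlev r)) => [x' [y' [rxy']]].
  by move=> /(@spair_inj 0)[] // /ind_inj -> /ind_inj ->.
exists (spair (ind x) (ind y)); split; first exact/pair_superP.
by apply/(mem_sset (@srel_superlev r)); exists x, y.
Qed.

Lemma op_superP f (x y z : T) :
  op_in (@smem T) id f (ind x) (ind y) (ind z) <-> f x y = z.
Proof.
have r2 a b : (rank (spair (@ind T a) (ind b)) <= 2)%N by exact: (@rank_spair 0).
split=> [[p [q [/pair_superP -> //]]]|<-].
  move/pair_superP => -> //.
  move/(mem_sset (@sgraph_superlev f)) => [x' [y']].
  move=> /(@spair_inj 2)[] // /(@spair_inj 0)[] // /ind_inj -> /ind_inj ->.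
  by move=> /ind_inj.
exists (spair (ind x) (ind y)), (spair (spair (ind x) (ind y)) (ind (f x y))).
split; [exact/pair_superP|exact/pair_superP|].
by apply/(mem_sset (@sgraph_superlev f)); exists x, y.
Qed.

End KuratowskiPairs.

(** * Kuratowski pairs, relations and operations as bounded formulas *)

Section BoundedFormulas.
Variables (T C : Type) (k : super T -> C).

Definition sbound (P : set (super T)) : {A : super T | entity A} :=
  exist _ (sset P) (@sset_entity T P).

Definition lift_term (V : Type) (t : term C V) : term C (option V) :=
  match t with Var v => Var C (Some v) | Cst c => Cst (option V) c end.

Definition FUpair (V : Type) n (d a b : term C V) : formula T C V :=
  FAnd (FIn T d (Cst V (k (slev T n.+1))))
    (FAll (sbound (@superlev T n))
      (let u := Var C None in
       let ab := FOr (FEq T u (lift_term a)) (FEq T u (lift_term b)) in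
       FAnd (FImp (FIn T u (lift_term d)) ab) (FImp ab (FIn T u (lift_term d))))).

Definition FPair (V : Type) n (p a b : term C V) : formula T C V :=
  let l t := lift_term (lift_term t) in
  let s := Var C (Some None) in let d := Var C None in
  FEx (sbound (@superlev T n.+1)) (FEx (sbound (@superlev T n.+1))
    (FAnd (FUpair n s (l a) (l a))
       (FAnd (FUpair n d (l a) (l b)) (FUpair n.+1 (l p) s d)))).

(** The bound of the quantifier is [srel r] itself, so it also expresses membership in the relation;
    [FOp] treats the graph in the same way. *)
Definition FRel (V : Type) r (x y : term C V) : formula T C V :=
  FEx (sbound [set p | exists x y, r x y /\ p = spair (ind x) (ind y)])
    (FPair 0 (Var C None) (lift_term x) (lift_term y)).

Definition FOp (V : Type) f (x y z : term C V) : formula T C V :=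
  let l t := lift_term (lift_term t) in
  let p := Var C (Some None) in let q := Var C None in
  FEx (sbound (@superlev T 2))
    (FEx (sbound [set p | exists x y,
            p = spair (spair (ind x) (ind y)) (ind (f x y))])
      (FAnd (FPair 0 p (l x) (l y)) (FPair 2 q p (l z)))).

Variables (U : Type) (mem : U -> U -> Prop) (bnd : super T -> U) (cst : C -> U).
Hypothesis cst_k : forall A, cst (k A) = bnd A.

Lemma eval_lift (V : Type) (env : V -> U) x t :
  eval cst (extend_env env x) (lift_term t) = eval cst env t.
Proof. by case: t. Qed.

Lemma sat_FUpair (V : Type) (env : V -> U) n d a b :
  sat mem bnd cst env (FUpair n d a b) <->
  upair_in mem bnd n (eval cst env d) (eval cst env a) (eval cst env b).
Proof.
rewrite /FUpair /upair_in /= cst_k; split=> -[dm h]; split=> // u /h;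
  by rewrite !eval_lift => -[h1 h2]; split.
Qed.

Lemma sat_FPair (V : Type) (env : V -> U) n p a b :
  sat mem bnd cst env (FPair n p a b) <->
  pair_in mem bnd n (eval cst env p) (eval cst env a) (eval cst env b).
Proof.
split=> [[s _ [d _ [/sat_FUpair+ [/sat_FUpair+ /sat_FUpair]]]]|[s [d [hs hd hp]]]].
  by rewrite !eval_lift => hs hd hp; exists s, d.
(* The bounds on [s] and [d] restrict nothing: they are the first clauses of [upair_in]. *)
exists s; first by case: hs.
exists d; first by case: hd.
by split; [|split]; apply/sat_FUpair; rewrite !eval_lift.
Qed.

Lemma sat_FRel (V : Type) (env : V -> U) r x y :
  sat mem bnd cst env (FRel r x y) <->
  rel_in mem bnd r (eval cst env x) (eval cst env y).
Proof.
split=> [[p hp /sat_FPair]|[p [hp pr]]].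
  by rewrite !eval_lift => pxy; exists p.
by exists p => //; apply/sat_FPair; rewrite !eval_lift.
Qed.

Lemma sat_FOp (V : Type) (env : V -> U) f x y z :
  sat mem bnd cst env (FOp f x y z) <->
  op_in mem bnd f (eval cst env x) (eval cst env y) (eval cst env z).
Proof.
split=> [[p _ [q hq [/sat_FPair + /sat_FPair]]]|[p [q [hp hq qf]]]].
  by rewrite !eval_lift => hp hz; exists p, q.
exists p; first by case: hp => s [d [_ _ []]].
by exists q => //; split; apply/sat_FPair; rewrite !eval_lift.
Qed.

End BoundedFormulas.

(** * Reading bounded formulas over the individuals *)

(** Quantifier-free language whose operation and relation symbols are arbitrary functions and
    relations on [T]; the ordered field laws are written and transferred in it. *)
Inductive rterm (T V : Type) : Type :=
  | RVar of V
  | RCst of T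
  | ROp of (T -> T -> T) & rterm T V & rterm T V.

Inductive rform (T V : Type) : Type :=
  | REq of rterm T V & rterm T V
  | RRel of (T -> T -> Prop) & rterm T V & rterm T V
  | RNot of rform T V
  | RImp of rform T V & rform T V
  | ROr of rform T V & rform T V.

Arguments RCst {T V}.
Arguments RVar {T V}.

Section QuantifierFreeFormulas.
Variables (T X : Type) (opX : (T -> T -> T) -> X -> X -> X).
Variables (relX : (T -> T -> Prop) -> X -> X -> Prop) (cstX : T -> X).

Fixpoint rval (V : Type) (e : V -> X) (t : rterm T V) : X :=
  match t with
  | RVar v => e v
  | RCst r => cstX r
  | ROp f s t => opX f (rval e s) (rval e t)
  end.

Fixpoint rsat (V : Type) (e : V -> X) (f : rform T V) : Prop :=
  match f with
  | REq s t => rval e s = rval e t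
  | RRel r s t => relX r (rval e s) (rval e t)
  | RNot f => ~ rsat e f
  | RImp f g => rsat e f -> rsat e g
  | ROr f g => rsat e f \/ rsat e g
  end.

Local Notation term := (term (super T)).
Local Notation formula := (formula T (super T)).
Local Notation individuals := (sbound (@superlev T 0)).

(** Bounded formulas have no function symbols, so a term is unnested: the values of its subterms
    become quantified individuals, linked by the graph of the operation. *)
Fixpoint FVal (V W : Type) (rho : V -> term W) (t : rterm T V) (z : term W) : formula W :=
  match t with
  | RVar v => FEq T (rho v) z
  | RCst r => FEq T (Cst W (ind r)) z
  | ROp f s t =>
    let l u := lift_term (lift_term u) in
    let a := Var _ (Some None) in let b := Var _ None in
    FEx individuals (FEx individuals
      (FAnd (FVal (l \o rho) s a)
         (FAnd (FVal (l \o rho) t b) (FOp id f a b (l z)))))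
  end.

Fixpoint FForm (V : Type) (f : rform T V) : formula V :=
  let a := Var _ (Some None) in let b := Var _ None in
  let rho v := Var _ (Some (Some v)) in
  match f with
  | REq s t => FEx individuals (FEx individuals
      (FAnd (FVal rho s a) (FAnd (FVal rho t b) (FEq T a b))))
  | RRel r s t => FEx individuals (FEx individuals
      (FAnd (FVal rho s a) (FAnd (FVal rho t b) (FRel id r a b))))
  | RNot f => FNot (FForm f)
  | RImp f g => FImp (FForm f) (FForm g)
  | ROr f g => FOr (FForm f) (FForm g)
  end.

Variables (U : Type) (mem : U -> U -> Prop) (cst : super T -> U) (inj : X -> U).
Hypothesis inj_inj : injective inj.
Hypothesis indE : forall u, mem u (cst (slev T 0)) <-> exists x, u = inj x.
Hypothesis cstE : forall r, cst (ind r) = inj (cstX r).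
Hypothesis opE : forall f x y z,
  op_in mem cst f (inj x) (inj y) (inj z) <-> opX f x y = z.
Hypothesis relE : forall r x y, rel_in mem cst r (inj x) (inj y) <-> relX r x y.

Let satOp V env f := @sat_FOp T _ id U mem cst cst (fun=> erefl) V env f.
Let satRel V env r := @sat_FRel T _ id U mem cst cst (fun=> erefl) V env r.

Lemma sat_all_ind (V : Type) (env : V -> U) f :
  sat mem cst cst env (FAll individuals f) <->
  forall x, sat mem cst cst (extend_env env (inj x)) f.
Proof.
split=> [h x|h u /indE[x ->] //]; apply: h.
by apply/indE; exists x.
Qed.

Lemma sat_ex_ind (V : Type) (env : V -> U) f :
  sat mem cst cst env (FEx individuals f) <->
  exists x, sat mem cst cst (extend_env env (inj x)) f.
Proof.
split=> [[u /indE[x ->] h]|[x h]]; first by exists x.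
by exists (inj x) => //; apply/indE; exists x.
Qed.

(** The environment is generalized in the induction because each operation adds two bound variables
    to the context. *)
Lemma sat_FVal (V : Type) (e : V -> X) (t : rterm T V) (W : Type) (env : W -> U) rho z x :
  (forall v, eval cst env (rho v) = inj (e v)) -> eval cst env z = inj x ->
  sat mem cst cst env (FVal rho t z) <-> rval e t = x.
Proof.
elim: t W env rho z x => [v|r|f s IHs t IHt] W env rho z x hrho hz.
- by rewrite /= hrho hz; split=> [/inj_inj|->].
- by rewrite /= cstE hz; split=> [/inj_inj|->].
rewrite [FVal _ _ _]/= sat_ex_ind [rval e _]/=.
have env2 a b v : eval cst (extend_env (extend_env env (inj a)) (inj b))
    (lift_term (lift_term (rho v))) = inj (e v).
  by rewrite !eval_lift.
split=> [[a /sat_ex_ind[b]]|fx].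
  case=> /(IHs _ _ _ _ a)-/(_ (env2 a b) erefl) -> [].
  move=> /(IHt _ _ _ _ b)-/(_ (env2 a b) erefl) -> ho.
  have /= := proj1 (satOp _ _ _ _ _) ho.
  by rewrite !eval_lift hz => /opE.
exists (rval e s); apply/sat_ex_ind; exists (rval e t).
split; first by apply/(IHs _ _ _ _ (rval e s) (env2 _ _)).
split; first by apply/(IHt _ _ _ _ (rval e t) (env2 _ _)).
by apply/satOp => //; rewrite /= !eval_lift hz; apply/opE.
Qed.

(** Serves two structures: the superstructure, with [inj] equal to [ind], and [M], with [inj] the
    projection of [hreal]. Transfer then relates the two readings of one formula. *)
Lemma sat_FForm (V : Type) (e : V -> X) (f : rform T V) (env : V -> U) :
  (forall v, env v = inj (e v)) -> sat mem cst cst env (FForm f) <-> rsat e f.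
Proof.
move=> henv.
pose rho v : term (option (option V)) := Var _ (Some (Some v)).
have env2 a b v : eval cst (extend_env (extend_env env (inj a)) (inj b))
    (rho v) = inj (e v) by exact: henv.
have satA t a b : sat mem cst cst (extend_env (extend_env env (inj a)) (inj b))
    (FVal rho t (Var _ (Some None))) <-> rval e t = a.
  by apply: sat_FVal => //; exact: env2.
have satB t a b : sat mem cst cst (extend_env (extend_env env (inj a)) (inj b))
    (FVal rho t (Var _ None)) <-> rval e t = b.
  by apply: sat_FVal => //; exact: env2.
elim: f => [s t|r s t|f IH|f IHf g IHg|f IHf g IHg];
  rewrite [rsat _ _]/= [FForm _]/=.
- rewrite sat_ex_ind; split=> [[a /sat_ex_ind[b]]|st].
    case=> /satA -> [].
    by move=> /satB -> /inj_inj.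
  exists (rval e s); apply/sat_ex_ind; exists (rval e t).
  split; first exact/satA.
  split; first exact/satB.
  by rewrite /= st.
- rewrite sat_ex_ind; split=> [[a /sat_ex_ind[b]]|st].
    case=> /satA -> [].
    move=> /satB ->.
    by move=> hr; apply/relE/(proj1 (satRel _ _ _ _) hr).
  exists (rval e s); apply/sat_ex_ind; exists (rval e t).
  split; first exact/satA.
  split; first exact/satB.
  by apply/satRel => //=; apply/relE.
- by split=> h /IH.
- by split=> h /IHf /h /IHg.
- by split=> -[/IHf|/IHg]; [left|right|left|right].
Qed.

Definition env3 (x y z : X) : option (option (option void)) -> X :=
  extend_env (extend_env (extend_env (@no_var X) x) y) z.

Lemma sat_FAll3 (f : rform T (option (option (option void)))) :
  sat mem cst cst (@no_var U) (FAll individuals (FAll individuals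
    (FAll individuals (FForm f)))) <->
  forall x y z, rsat (env3 x y z) f.
Proof.
have env3E x y z v : extend_env (extend_env (extend_env (@no_var U) (inj x))
    (inj y)) (inj z) v = inj (env3 x y z v).
  by case: v => [[[[]|]|]|].
rewrite sat_all_ind; split=> h x.
  by move=> y z; move/sat_all_ind/(_ y)/sat_all_ind/(_ z)/(sat_FForm _ (env3E _ _ _)) : (h x).
by apply/sat_all_ind => y; apply/sat_all_ind => z; exact/(sat_FForm _ (env3E _ _ _)).
Qed.

End QuantifierFreeFormulas.

(** * Hyperreal numbers as a real field *)

Section HyperrealTransfer.
Variables (R : realType) (M : nonstandard_model R).
Implicit Types x y z : hreal M.

Lemma hreal_inj : injective (fun x => sval x).
Proof.
move=> [x hx] [y hy] /= xy; subst y; congr exist; exact: Prop_irrelevance.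
Qed.

Lemma hreal_indE (u : M) :
  nsmem u (star M (slev R 0)) <-> exists x, u = sval x.
Proof.
split=> [hu|[[x hx] -> //]].
by exists (exist (fun u : M => nsmem u (star M (slev R 0))) _ hu).
Qed.

Lemma super_indE (u : super R) : smem u (slev R 0) <-> exists r, u = ind r.
Proof.
split=> [/mem_slev|[r ->]]; last exact/mem_slev.
have := superlev0 R; rewrite /superlev => e u0.
have : range (@ind R) u by rewrite -e.
by move=> [r _ <-]; exists r.
Qed.

Let satM (V : Type) env f s t u :=
  @sat_FOp R _ id M (@nsmem R M) (star M) (star M) (fun=> erefl) V env f s t u.
Let satS (V : Type) env f s t u :=
  @sat_FOp R _ id _ (@smem R) id id (fun=> erefl) V env f s t u.

(** Transfer of the totality of [f]. With the transferred uniqueness in [hop_uniq], it shows that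
    [hop] never takes its default value. *)
Lemma hop_ex f x y :
  exists z, op_in (@nsmem R M) (star M) f (sval x) (sval y) (sval z).
Proof.
pose F : formula R (super R) void :=
  FAll (sbound (@superlev R 0)) (FAll (sbound (@superlev R 0))
    (FEx (sbound (@superlev R 0))
      (FOp id f (Var _ (Some (Some None))) (Var _ (Some None)) (Var _ None)))).
have : sat (@smem R) id id (@no_var (super R)) F.
  apply/(sat_all_ind super_indE) => r; apply/(sat_all_ind super_indE) => s.
  apply/(sat_ex_ind super_indE); exists (f r s); apply/satS.
  exact/op_superP.
move=> /(@transfer _ M)/(sat_all_ind hreal_indE)/(_ x).
move=> /(sat_all_ind hreal_indE)/(_ y)/(sat_ex_ind hreal_indE)[z] /satM.
by exists z.
Qed.

Lemma hop_uniq f x y z z' :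
  op_in (@nsmem R M) (star M) f (sval x) (sval y) (sval z) ->
  op_in (@nsmem R M) (star M) f (sval x) (sval y) (sval z') -> z = z'.
Proof.
pose F : formula R (super R) void :=
  FAll (sbound (@superlev R 0)) (FAll (sbound (@superlev R 0))
    (FAll (sbound (@superlev R 0)) (FAll (sbound (@superlev R 0))
      (FImp (FOp id f (Var _ (Some (Some (Some None))))
               (Var _ (Some (Some None))) (Var _ (Some None)))
         (FImp (FOp id f (Var _ (Some (Some (Some None))))
               (Var _ (Some (Some None))) (Var _ None))
            (FEq _ (Var _ (Some None)) (Var _ None))))))).
have : sat (@smem R) id id (@no_var (super R)) F.
  apply/(sat_all_ind super_indE) => r; apply/(sat_all_ind super_indE) => s.
  apply/(sat_all_ind super_indE) => t; apply/(sat_all_ind super_indE) => t'.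
  move=> h1 h2; have /op_superP e1 := proj1 (satS _ _ _ _ _) h1.
  have /op_superP e2 := proj1 (satS _ _ _ _ _) h2.
  by rewrite /= -e1 -e2.
move=> /(@transfer _ M)/(sat_all_ind hreal_indE)/(_ x).
move=> /(sat_all_ind hreal_indE)/(_ y)/(sat_all_ind hreal_indE)/(_ z).
move=> /(sat_all_ind hreal_indE)/(_ z') h hz hz'.
by apply: hreal_inj; apply: h; exact/satM.
Qed.

Lemma hopP f x y z :
  op_in (@nsmem R M) (star M) f (sval x) (sval y) (sval z) <-> hop f x y = z.
Proof.
have hf : op_in (@nsmem R M) (star M) f (sval x) (sval y) (sval (hop f x y)).
  rewrite /hop; case: xgetP => [? _ //|].
  by have [w hw] := hop_ex f x y => /(_ w).
by split=> [/(hop_uniq hf)|<-].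
Qed.

(** Three variables are enough for the ordered field laws; laws in fewer variables are applied with
    repeated arguments. *)
Lemma hreal_transfer (F : rform R (option (option (option void)))) :
  (forall r s t, rsat (fun f => f) (fun p => p) id (env3 r s t) F) ->
  forall x y z, rsat (@hop R M) (@hrel R M) (hinj M) (env3 x y z) F.
Proof.
move=> h.
have := proj2 (sat_FAll3 (@ind_inj R) super_indE (fun=> erefl) (@op_superP R)
  (@rel_superP R) F) h.
move=> /(@transfer _ M).
have hrE r x y : rel_in (@nsmem R M) (star M) r (sval x) (sval y) <-> hrel r x y.
  by [].
have := @sat_FAll3 R (hreal M) (@hop R M) (@hrel R M) (hinj M) M (@nsmem R M)
  (star M) (fun x => sval x) hreal_inj hreal_indE (fun=> erefl) hopP hrE F.
by case.
Qed.

End HyperrealTransfer.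

Notation rX := (RVar (Some (Some None))).
Notation rY := (RVar (Some None)).
Notation rZ := (RVar None).

Section HyperrealField.
Variables (R : realType) (M : nonstandard_model R).
Local Notation hreal := (hreal M).
Implicit Types x y z : hreal.

Local Notation sub_ := (ROp (fun r s : R => r - s)).
Local Notation mul_ := (ROp (fun r s : R => r * s)).
Local Notation div_ := (ROp (fun r s : R => r / s)).
Local Notation lt_ := (RRel (fun r s : R => r < s)).
Local Notation add_ s t := (sub_ s (sub_ (RCst (0 : R)) t)).

(** Addition and inverse are built from the subtraction and division of the decomposition process.
    Terms written with [add_] unfold to [hadd], so transferred sentences match the goals by
    conversion. *)
Definition hadd x y := hsub x (hsub (hinj M 0) y).
Definition hopp x := hsub (hinj M 0) x.
Definition hinv x := hdiv (hinj M 1) x.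

Lemma haddA : associative hadd.
Proof.
move=> x y z; apply: (hreal_transfer
  (F := REq (add_ rX (add_ rY rZ)) (add_ (add_ rX rY) rZ)) _ x y z) => r s t /=.
ring.
Qed.

Lemma haddC : commutative hadd.
Proof.
move=> x y; apply: (hreal_transfer (F := REq (add_ rX rY) (add_ rY rX)) _ x y x).
by move=> r s t /=; ring.
Qed.

Lemma hadd0 : left_id (hinj M 0) hadd.
Proof.
move=> x; apply: (hreal_transfer (F := REq (add_ (RCst 0) rX) rX) _ x x x).
by move=> r s t /=; ring.
Qed.

Lemma haddN : left_inverse (hinj M 0) hopp hadd.
Proof.
move=> x; apply: (hreal_transfer
  (F := REq (add_ (sub_ (RCst 0) rX) rX) (RCst 0)) _ x x x).
by move=> r s t /=; ring.
Qed.

Lemma hmulA : associative (@hmul R M).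
Proof.
move=> x y z; apply: (hreal_transfer
  (F := REq (mul_ rX (mul_ rY rZ)) (mul_ (mul_ rX rY) rZ)) _ x y z) => r s t /=.
ring.
Qed.

Lemma hmulC : commutative (@hmul R M).
Proof.
move=> x y; apply: (hreal_transfer (F := REq (mul_ rX rY) (mul_ rY rX)) _ x y x).
by move=> r s t /=; ring.
Qed.

Lemma hmul1 : left_id (hinj M 1) (@hmul R M).
Proof.
move=> x; apply: (hreal_transfer (F := REq (mul_ (RCst 1) rX) rX) _ x x x).
by move=> r s t /=; ring.
Qed.

Lemma hmulDl : left_distributive (@hmul R M) hadd.
Proof.
move=> x y z; apply: (hreal_transfer (F := REq (mul_ (add_ rX rY) rZ)
  (add_ (mul_ rX rZ) (mul_ rY rZ))) _ x y z) => r s t /=.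
ring.
Qed.

Lemma hinj_inj : injective (hinj M).
Proof. move=> r s e; apply/ind_inj/(@star_inj _ M).
by have := congr1 (fun x => sval x) e. Qed.

Lemma hone_neq0 : hinj M 1 != hinj M 0.
Proof. by apply/eqP => e; have /eqP := hinj_inj e; rewrite oner_eq0. Qed.

Lemma hmulVf x : x != hinj M 0 -> hmul (hinv x) x = hinj M 1.
Proof.
move=> /eqP; apply: (hreal_transfer (F := RImp (RNot (REq rX (RCst 0)))
  (REq (mul_ (div_ (RCst 1) rX) rX) (RCst 1))) _ x x x) => r s t /= /eqP r0.
by rewrite div1r mulVf.
Qed.

Lemma hinv0 : hinv (hinj M 0) = hinj M 0.
Proof.
pose x := hinj M 0; apply: (hreal_transfer
  (F := REq (div_ (RCst 1) (RCst 0)) (RCst 0)) _ x x x) => r s t /=.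
by rewrite invr0 mulr0.
Qed.

HB.instance Definition _ := GRing.isZmodule.Build hreal haddA haddC hadd0 haddN.
HB.instance Definition _ := GRing.Zmodule_isComNzRing.Build hreal
  hmulA hmulC hmul1 hmulDl hone_neq0.
HB.instance Definition _ := GRing.ComNzRing_isField.Build hreal hmulVf hinv0.

Definition hltb x y : bool := `[< hlt x y >].
Definition hleb x y : bool := (x == y) || hltb x y.

Lemma hltb_add x y : hltb 0 x -> hltb 0 y -> hltb 0 (x + y).
Proof.
move=> /asboolP h1 /asboolP h2; apply/asboolP; move: h1 h2.
apply: (hreal_transfer (F := RImp (lt_ (RCst 0) rX) (RImp (lt_ (RCst 0) rY)
  (lt_ (RCst 0) (add_ rX rY)))) _ x y x) => r s t /=.
by move=> *; rewrite sub0r opprK addr_gt0.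
Qed.

Lemma hltb_mul x y : hltb 0 x -> hltb 0 y -> hltb 0 (x * y).
Proof.
move=> /asboolP h1 /asboolP h2; apply/asboolP; move: h1 h2.
apply: (hreal_transfer (F := RImp (lt_ (RCst 0) rX) (RImp (lt_ (RCst 0) rY)
  (lt_ (RCst 0) (mul_ rX rY)))) _ x y x) => r s t /=.
exact: mulr_gt0.
Qed.

Lemma hltb_asym x : hltb 0 x -> ~~ hltb x 0.
Proof.
move=> /asboolP h1; apply/asboolP; move: h1.
apply: (hreal_transfer (F := RImp (lt_ (RCst 0) rX)
  (RNot (lt_ rX (RCst 0)))) _ x x x) => r s t /= r0.
by apply/negP; rewrite -leNgt ltW.
Qed.

Lemma hltb_sub x y : hltb 0 (y - x) = hltb x y.
Proof.
apply/asboolP/asboolP; move: x y.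
  move=> x y; apply: (hreal_transfer (F := RImp
    (lt_ (RCst 0) (add_ rY (sub_ (RCst 0) rX))) (lt_ rX rY)) _ x y x) => r s t /=.
  by rewrite !sub0r opprK subr_gt0.
move=> x y; apply: (hreal_transfer (F := RImp (lt_ rX rY)
    (lt_ (RCst 0) (add_ rY (sub_ (RCst 0) rX)))) _ x y x) => r s t /=.
by rewrite !sub0r opprK subr_gt0.
Qed.

Lemma hltb_total x : x != 0 -> hltb 0 x || hltb x 0.
Proof.
move=> /eqP h1; suff : hlt 0 x \/ hlt x 0.
  by case=> h; apply/orP; [left|right]; apply/asboolP.
move: h1; apply: (hreal_transfer (F := RImp (RNot (REq rX (RCst 0)))
  (ROr (lt_ (RCst 0) rX) (lt_ rX (RCst 0)))) _ x x x) => r s t /= /eqP.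
by rewrite neq_lt => /orP[]; [right|left].
Qed.

Lemma hsubE x y : hsub x y = x - y.
Proof.
apply: (hreal_transfer (F := REq (sub_ rX rY)
  (add_ rX (sub_ (RCst 0) rY))) _ x y x) => r s t /=.
by rewrite !sub0r opprK.
Qed.

Lemma hsub0N x : hsub 0 x = - x.
Proof. by rewrite hsubE sub0r. Qed.

Lemma hltb_oppr x : hltb (- x) 0 = hltb 0 x.
Proof. by rewrite -hltb_sub sub0r opprK. Qed.

Lemma habsN x : habs (- x) = habs x.
Proof.
rewrite /habs -/(hltb (- x) 0) -/(hltb x 0) hltb_oppr !hsub0N opprK.
have [->|x0] := eqVneq x 0; first by rewrite oppr0 !if_same.
case: (boolP (hltb 0 x)) => [/hltb_asym/negbTE -> //|nx].
by have := hltb_total x0; rewrite (negbTE nx) /= => ->.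
Qed.

Lemma habs_ge0 x : hleb 0 x -> habs x = x.
Proof.
rewrite /habs -/(hltb x 0) => /orP[/eqP <-|/hltb_asym/negbTE -> //].
by rewrite hsub0N oppr0 if_same.
Qed.

Lemma hleb_def x y : hleb x y = (x == y) || hltb x y.
Proof. by []. Qed.

HB.instance Definition _ := Num.IntegralDomain_isLtReal.Build hreal
  hltb_add hltb_mul hltb_asym hltb_sub hltb_total habsN habs_ge0 hleb_def.

Lemma hltE x y : hlt x y <-> x < y.
Proof. by split=> /asboolP. Qed.

Lemma habsE x : habs x = `|x|.
Proof. by []. Qed.

Lemma hmulE x y : hmul x y = x * y.
Proof. by []. Qed.

Lemma hdivE x y : hdiv x y = x / y.
Proof.
apply: (hreal_transfer (F := REq (div_ rX rY)
  (mul_ rX (div_ (RCst 1) rY))) _ x y x) => r s t /=.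
by rewrite div1r.
Qed.

Lemma hinj1 : hinj M 1 = 1. Proof. by []. Qed.

Lemma hinjB : {morph hinj M : r s / r - s}.
Proof.
move=> r s; rewrite -hsubE; apply/esym.
by apply: (hreal_transfer (F := REq (sub_ (RCst r) (RCst s)) (RCst (r - s)))
  _ 0 0 0) => *.
Qed.

Lemma hinjM : {morph hinj M : r s / r * s}.
Proof.
move=> r s; apply/esym.
by apply: (hreal_transfer (F := REq (mul_ (RCst r) (RCst s)) (RCst (r * s)))
  _ 0 0 0) => *.
Qed.

HB.instance Definition _ := GRing.isZmodMorphism.Build R hreal (hinj M) hinjB.
HB.instance Definition _ := GRing.isMonoidMorphism.Build R hreal (hinj M)
  (conj hinj1 hinjM).

Lemma ltr_hinj r s : (hinj M r < hinj M s) = (r < s).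
Proof.
suff h a b : a < b -> hinj M a < hinj M b.
  apply/idP/idP => [|/h //]; apply: contraTT; rewrite -!leNgt le_eqVlt.
  by move=> /orP[/eqP -> //|/h/ltW].
move=> ab; apply/hltE.
by apply: (hreal_transfer (F := lt_ (RCst a) (RCst b)) _ 0 0 0) => *.
Qed.

End HyperrealField.

(** * Orders of magnitude *)

Section OrdersOfMagnitude.
Variables R F : realFieldType.

(** This is u = o(v), and [domin] is u = O(v), with constants from [R]. The strict inequalities
    force [v] to be nonzero. *)
Definition negl (h : R -> F) (u v : F) : Prop :=
  forall e : R, 0 < e -> `|u| < h e * `|v|.

Definition domin (h : R -> F) (u v : F) : Prop :=
  exists K : R, `|u| < h K * `|v|.

Variable h : {rmorphism R -> F}.
Hypothesis ltr_h : {mono h : r s / r < s}.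
Implicit Types (u v w x a b p q : F) (r s : R).

Lemma ler_mono r s : (h r <= h s) = (r <= s).
Proof. by rewrite !leNgt ltr_h. Qed.

Lemma mono_norm r : h `|r| = `|h r|.
Proof.
have [r0|r0] := lerP 0 r; first by rewrite !ger0_norm // -(rmorph0 h) ler_mono.
by rewrite !ltr0_norm ?rmorphN // -(rmorph0 h) ltr_h.
Qed.

Lemma mono_gt0 r : (0 < h r) = (0 < r).
Proof. by rewrite -(rmorph0 h) ltr_h. Qed.

Lemma half_sum r : h r = h (r / 2) + h (r / 2).
Proof. by rewrite -rmorphD; congr (h _); lra. Qed.

Lemma negl0 v : v != 0 -> negl h 0 v.
Proof. by move=> v0 e e0; rewrite normr0 mulr_gt0 ?normr_gt0 ?mono_gt0. Qed.

Lemma neglD u v w : negl h u w -> negl h v w -> negl h (u + v) w.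
Proof.
move=> uw vw e e0; have e20 : 0 < e / 2 by lra.
have := ler_normD u v; have := uw _ e20; have := vw _ e20.
by rewrite (half_sum e) mulrDl; lra.
Qed.

(** If u = O(v) and v = o(w) then u = o(w). The factor [|r| + 1] is used to rescale [e] because it
    is positive whatever the sign of [r]. *)
Lemma negl_le r u v w : `|u| < h r * `|v| -> negl h v w -> negl h u w.
Proof.
move=> uv vw e e0; have c0 : 0 < `|r| + 1 by rewrite ltr_wpDl.
have := vw (e / (`|r| + 1)) (divr_gt0 e0 c0).
have -> : h e = h (`|r| + 1) * h (e / (`|r| + 1)).
  by rewrite -rmorphM mulrC divfK ?gt_eqF.
rewrite -mulrA -(ltr_pM2l (x := h (`|r| + 1))) ?mono_gt0 //; apply: le_lt_trans.
rewrite (le_trans (ltW uv)) // ler_wpM2r // ler_mono.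
by rewrite (le_trans (ler_norm r)) // lerDl.
Qed.

Lemma neglZ r u v : negl h u v -> negl h (h r * u) v.
Proof.
have [->|u0] := eqVneq u 0; first by rewrite mulr0.
apply: (@negl_le (`|r| + 1)); rewrite normrM -mono_norm ltr_pM2r ?normr_gt0 //.
by rewrite ltr_h; lra.
Qed.

Lemma domin_gt0 u v r : `|u| < h r * `|v| -> 0 < r /\ 0 < `|v|.
Proof.
move=> uv; have := le_lt_trans (normr_ge0 u) uv.
have [->|v0] := eqVneq v 0; first by rewrite normr0 mulr0 ltxx.
by rewrite pmulr_lgt0 ?normr_gt0 // mono_gt0.
Qed.

Lemma domin_trans v u w : domin h u v -> domin h v w -> domin h u w.
Proof.
move=> [K uv] [L vw]; exists (K * L); have [K0 _] := domin_gt0 uv.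
by rewrite rmorphM -mulrA (lt_trans uv)// ltr_pM2l ?mono_gt0.
Qed.

Lemma domin_refl u : u != 0 -> domin h u u.
Proof.
by move=> u0; exists 2; rewrite ltr_pMl ?normr_gt0 // -(rmorph1 h) ltr_h; lra.
Qed.

Lemma negl_of_not_domin x y u v : domin h u x -> domin h y v -> ~ domin h y x ->
  negl h u v.
Proof.
move=> [K ux] [L yv] nyx e e0.
have [K0 _] := domin_gt0 ux; have [L0 _] := domin_gt0 yv.
(* If e|v| <= |u|, then |y| < L|v| <= (L/e)|u| < (L/e)K|x|. *)
rewrite ltNge; apply/negP => vu; apply: nyx; exists (L / e * K).
rewrite (lt_le_trans yv) // rmorphM -mulrA.
have -> : h L = h (L / e) * h e by rewrite -rmorphM divfK ?gt_eqF.
rewrite -mulrA ler_wpM2l ?(le_trans vu) 1?ltW //.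
by rewrite mono_gt0 divr_gt0.
Qed.

(** An error below half of |r||v| leaves |u| above (|r|/2)|v|, and an error below |v| leaves it
    below (|r|+1)|v|. *)
Lemma negl_subZ_domin r u v : r != 0 -> v != 0 -> negl h (u - h r * v) v ->
  [/\ u != 0, domin h u v & domin h v u].
Proof.
move=> r0 v0 ur; have r20 : 0 < `|r| / 2 by rewrite divr_gt0 // normr_gt0.
have vu : h (`|r| / 2) * `|v| < `|u|.
  have := ur _ r20; have := ler_normB u (u - h r * v); rewrite subKr.
  rewrite normrM -mono_norm (half_sum `|r|) mulrDl; lra.
split.
- rewrite -normr_gt0 (le_lt_trans _ vu) // mulr_ge0 // ltW //.
  by rewrite mono_gt0.
- exists (`|r| + 1); rewrite rmorphD mulrDl.
  have := ur _ ltr01; have := ler_normD (u - h r * v) (h r * v).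
  by rewrite subrK normrM -mono_norm; lra.
- exists (2 / `|r|).
  have -> : `|v| = h (2 / `|r|) * (h (`|r| / 2) * `|v|).
    rewrite mulrA -rmorphM -[LHS]mul1r -(rmorph1 h); congr (h _ * _).
    by field; rewrite normr_eq0.
  by rewrite ltr_pM2l // mono_gt0 divr_gt0 // normr_gt0.
Qed.

(** The case e = 1 of the hypothesis; it supplies the radius of the intervals to which saturation is
    applied. *)
Lemma negl_subZ_lt r u v : negl h (u - h r * v) v ->
  `|u| < h (`|r| + 1) * `|v|.
Proof.
move=> /(_ _ ltr01); have := ler_normD (u - h r * v) (h r * v).
by rewrite subrK normrM -mono_norm rmorphD mulrDl; lra.
Qed.

Lemma close_unique r s x : (forall e, 0 < e -> `|x - h r| < h e) ->
  (forall e, 0 < e -> `|x - h s| < h e) -> s = r.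
Proof.
move=> xr xs; apply/eqP; apply: contrapT => /negP sr.
have d0 : 0 < `|s - r| / 2 by rewrite divr_gt0 // normr_gt0 subr_eq0.
have := xs _ d0; have := xr _ d0; have := ler_normB (x - h r) (x - h s).
have -> : x - h r - (x - h s) = h (s - r) by rewrite rmorphB; lra.
by rewrite -mono_norm (half_sum `|s - r|); lra.
Qed.

(** Here [b - a - w] is the remainder of [b] after a partial sum [a] and a term [w] of size [p]:
    adding a term of smaller order to [b] does not spoil it. *)
Lemma negl_shift a b p v w : negl h (b - a - w) p -> negl h v p ->
  negl h (b + v - a - w) p.
Proof.
move=> h1 h2; have -> : b + v - a - w = b - a - w + v by ring.
exact: neglD h1 h2.
Qed.

(** The same remainder survives the replacement of [b] by any [x] with x - b = O(q) and q = o(p). *)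
Lemma negl_near r a b p q w x : `|x - b| < h r * `|q| -> negl h q p ->
  negl h (b - a - w) p -> negl h (x - a - w) p.
Proof.
move=> h1 h2 h3; have -> : x - a - w = b - a - w + (x - b) by ring.
exact: (neglD h3 (negl_le h1 h2)).
Qed.

End OrdersOfMagnitude.

(** * Classes of magnitude and standard parts of hyperreals *)

Section StandardPart.
Variables (R : realType) (M : nonstandard_model R).
Local Notation hreal := (hreal M).
Local Notation h := (hinj M).
Implicit Types x y z u v a b : hreal.

Lemma inf_closeP x r : inf_close x (h r) <-> forall e, 0 < e -> `|x - h r| < h e.
Proof.
by split=> xr e /xr; [move/hltE|move=> k; apply/hltE]; rewrite habsE hsubE.
Qed.

Lemma hfinite_div u v : v != 0 -> hfinite (hdiv u v) <-> domin h u v.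
Proof.
move=> v0; have v0' : 0 < `|v| by rewrite normr_gt0.
by split=> -[K uv]; exists K; [move/hltE : uv|apply/hltE];
  rewrite habsE hdivE normf_div ltr_pdivrMr.
Qed.

Lemma hsimP u v : u != 0 -> v != 0 -> hsim u v <-> domin h u v /\ domin h v u.
Proof. by move=> u0 v0; rewrite /hsim !hfinite_div. Qed.

Lemma clsP u w : u != 0 -> cls u w <-> [/\ w != 0, domin h u w & domin h w u].
Proof.
move=> u0; split=> [[/eqP w0 /(hsimP u0 w0)[]]//|[w0 uw wu]].
by split; [exact/eqP|exact/hsimP].
Qed.

Lemma cls_refl u : u != 0 -> cls u u.
Proof.
by move=> u0; apply/clsP => //; split=> //; exact: (domin_refl (ltr_hinj M)).
Qed.

Lemma hdomin_trans v u w : domin h u v -> domin h v w -> domin h u w.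
Proof. exact: (domin_trans (ltr_hinj M)). Qed.

Lemma cls_eq u v : u != 0 -> v != 0 -> domin h u v -> domin h v u -> cls u = cls v.
Proof.
suff sub u' v' : u' != 0 -> v' != 0 -> domin h u' v' -> domin h v' u' ->
    cls u' `<=` cls v'.
  by move=> u0 v0 uv vu; apply/seteqP; split; exact: sub.
move=> u0 v0 uv vu w /(clsP _ u0)[w0 uw wu]; apply/(clsP _ v0).
by split; [exact: w0|exact: hdomin_trans vu uw|exact: hdomin_trans wu uv].
Qed.

Lemma st_unique x (r : R) : inf_close x (h r) -> st x = r.
Proof.
move=> xr; rewrite /st; case: xgetP => [s _ xs|/(_ r)//].
exact: (close_unique (ltr_hinj M) (proj1 (inf_closeP x r) xr)
  (proj1 (inf_closeP x s) xs)).
Qed.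

(** By completeness of the reals: the standard part is the supremum of the reals below [x]. *)
Lemma st_inf_close x : hfinite x -> inf_close x (h (st x)).
Proof.
move=> [K /hltE]; rewrite habsE ltr_norml -rmorphN => /andP[Kx xK].
suff [r xr] : exists r, inf_close x (h r) by rewrite (st_unique xr).
pose A := [set r : R | h r <= x].
have hA : has_sup A.
  split; first by exists (- K); rewrite /A /= ltW.
  exists K => r /le_lt_trans/(_ xK); rewrite ltr_hinj; exact: ltW.
exists (sup A); apply/inf_closeP => e e0; rewrite ltr_norml.
have [r Ar rs] : exists2 r, A r & sup A - e < r by exact: sup_adherent.
apply/andP; split.
  by rewrite ltrBrDr addrC -rmorphN -rmorphD (lt_le_trans _ Ar) ?ltr_hinj.
(* Otherwise the supremum increased by [e] would still belong to [A]. *)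
rewrite ltrBlDr -rmorphD ltNge; apply/negP => /(ub_le_sup (proj2 hA)).
by lra.
Qed.

End StandardPart.

(** * Leading coefficient and class of a single element *)

Section Coefficients.
Variables (R : realType) (M : nonstandard_model R) (prec : rel (hreal M)).
Hypothesis prec_wo : well_order prec.
Local Notation hreal := (hreal M).
Local Notation h := (hinj M).
Implicit Types (x y z u v a b : hreal) (l : Lambda M).

Lemma prec_min_in (A : set hreal) x : A x -> A (prec_min prec A).
Proof.
move=> Ax; have [m [[/asboolP Am minm] _]] :=
  @prec_wo (fun y => `[< A y >]) (ex_intro _ x (introT (asboolP _) Ax)).
rewrite /prec_min; case: xgetP => [a _ []//|/(_ m) nm].
by case: nm; split=> // y Ay; apply: minm; exact/asboolP.
Qed.

(** The chosen representative $a_\lambda$ of the class. *)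
Definition mag l : hreal := prec_min prec (sval l).

Lemma mag_spec l : mag l != 0 /\ cls (mag l) = sval l.
Proof.
have [x /eqP x0 lx] := svalP l.
have /(clsP _ x0)[m0 h1 h2] : cls x (mag l).
  by rewrite /mag lx; apply: (prec_min_in (x := x)); exact: cls_refl.
split=> //.
by rewrite lx; exact: cls_eq.
Qed.

Lemma mag_domin l x : x != 0 -> sval l = cls x ->
  domin h x (mag l) /\ domin h (mag l) x.
Proof.
move=> x0 lx; have [m0 ml] := mag_spec l.
by have /(clsP _ x0)[] : cls x (mag l) by rewrite -lx -ml; exact: cls_refl.
Qed.

(** For representatives with |x| < |y|, the relation y = O(x) would make the two classes equal;
    without it, everything of the size of [x] is negligible against everything of the size of
    [y]. *)
Lemma mag_lt l l' : Lambda_lt l l' -> negl h (mag l) (mag l').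
Proof.
move=> [ll' [x [y [/eqP x0 /eqP y0 lx ly /hltE xy]]]].
have [_ mx] := mag_domin x0 lx; have [ym _] := mag_domin y0 ly.
apply: (negl_of_not_domin (ltr_hinj M) mx ym) => yx.
apply: ll'; suff : sval l = sval l'.
  case: (l) (l') => [a ha] [b hb] /= ab; subst b; congr exist.
  exact: Prop_irrelevance.
rewrite lx ly; apply: cls_eq => //; exists 1; rewrite hinj1 mul1r.
exact: xy.
Qed.

Lemma coef_close u l : u != 0 -> cls u = sval l ->
  negl h (u - h (coef prec u) * mag l) (mag l).
Proof.
move=> u0 ul e e0; have [m0 _] := mag_spec l.
have [um _] := mag_domin u0 (esym ul).
have /inf_closeP/(_ e e0) := st_inf_close (proj2 (hfinite_div u m0) um).
rewrite hdivE /coef hdivE ul -/(mag l).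
by rewrite -[X in _ - X](mulfK m0) -mulrBl normf_div ltr_pdivrMr ?normr_gt0.
Qed.

(** Converse of [coef_close]: as [r] is nonzero, the term [h r * mag l] dominates [u] and fixes its
    class, and uniqueness of the standard part fixes the coefficient. *)
Lemma negl_coef u l (r : R) : r != 0 -> negl h (u - h r * mag l) (mag l) ->
  [/\ u != 0, cls u = sval l & coef prec u = r].
Proof.
move=> r0 ur; have [m0 ml] := mag_spec l.
have [u0 um mu] := negl_subZ_domin (ltr_hinj M) r0 m0 ur.
have ul : cls u = sval l by rewrite -ml; exact: cls_eq.
split=> //; apply: st_unique; apply/inf_closeP => e e0.
rewrite hdivE ul -/(mag l).
rewrite -[X in _ - X](mulfK m0) -mulrBl normf_div ltr_pdivrMr ?normr_gt0 //.
exact: ur.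
Qed.

End Coefficients.

(** * Well-orders and their initial segments *)

Section WellOrders.
Variable I : wotype.
Implicit Types i j k : I.

Lemma wo_min (A : set I) i : A i -> exists m, A m /\ forall j, A j -> wole m j.
Proof.
move=> Ai; have [m [[/asboolP Am minm] _]] :=
  @wole_wo I (fun j => `[< A j >]) (ex_intro _ i (introT (asboolP _) Ai)).
by exists m; split=> // j Aj; apply: minm; exact/asboolP.
Qed.

Lemma wole_refl i : wole i i.
Proof.
have [m [/= -> h]] := @wo_min [set j | j = i] i erefl.
exact: h.
Qed.

(** [well_order] provides unique least elements, and both [i] and [j] are least in {i, j}. *)
Lemma wole_anti i j : wole i j -> wole j i -> i = j.
Proof.
move=> ij ji; have [m [_ um]] := @wole_wo I (fun k => `[< k = i \/ k = j >])
  (ex_intro _ i (introT (asboolP _) (or_introl erefl))).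
have <- : m = i.
  by apply: um; split=> [|k /asboolP[->|->]] //; [apply/asboolP; left|exact: wole_refl].
by apply: um; split=> [|k /asboolP[->|->]] //; [apply/asboolP; right|exact: wole_refl].
Qed.

Lemma wolt_asym i j : wolt i j -> wole j i -> False.
Proof. by move=> [ij nij] ji; apply/nij/wole_anti. Qed.

Lemma wolt_total i j : [\/ i = j, wolt i j | wolt j i].
Proof.
have [ij|nij] := pselect (i = j); first by constructor 1.
have [m [[]/= -> h]] := @wo_min [set k | k = i \/ k = j] i (or_introl erefl).
  by constructor 2; split=> //; apply: h; right.
by constructor 3; split; [apply: h; left|move/esym].
Qed.

Lemma wolt_trans i j k : wolt i j -> wolt j k -> wolt i k.
Proof.
move=> ij jk; split; last by move=> ik; subst k; case: jk => ji _; exact: (wolt_asym ij).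
have [m [[-> |[->|->]] h]] :=
  @wo_min [set l | l = i \/ (l = j \/ l = k)] i (or_introl erefl).
- by apply: h; right; right.
- by exfalso; apply: (wolt_asym ij); apply: h; left.
- by exfalso; apply: (wolt_asym jk); apply: h; right; left.
Qed.

Lemma wole_or_lt i j : wole i j \/ wolt j i.
Proof.
by have [->|[]|] := wolt_total i j; [left; exact: wole_refl|left|right].
Qed.

Lemma wole_eq_lt i j : wole i j -> i = j \/ wolt i j.
Proof.
by move=> ij; have [->|] := pselect (i = j); [left|right; split].
Qed.

(** The given element [i] is the bound for the empty list. *)
Lemma seq_bound (D : set I) (i : I) (s : seq I) : D i ->
  (forall j, List.In j s -> D j) ->
  exists2 m, D m & forall j, List.In j s -> wole j m.
Proof.
move=> Di; elim: s => [|k s IH] sD; first by exists i.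
have [|m Dm sm] := IH; first by move=> j js; apply: sD; right.
have [km|mk] := wole_or_lt k m.
  by exists m => // j [<-//|]; exact: sm.
exists k; first by apply: sD; left.
move=> j [<-|/sm jm]; first exact: wole_refl.
by have [->|jm'] := wole_eq_lt jm; [case: mk|case: (wolt_trans jm' mk)].
Qed.

End WellOrders.

(* [sim i j] holds when the initial segments below [i] and [j] have the same
   order type. *)
Inductive sim (I J : wotype) (i : I) (j : J) : Prop := Sim of
  (forall i', wolt i' i -> exists2 j', wolt j' j & sim i' j') &
  (forall j', wolt j' j -> exists2 i', wolt i' i & sim i' j').

(** Equality of order types for initial segments themselves, so that the whole order, which is not
    below any index, is covered too. *)
Definition matching (I J : wotype) (D : set I) (E : set J) : Prop :=
  (forall i, D i -> exists2 j, E j & sim i j) /\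
  (forall j, E j -> exists2 i, D i & sim i j).

Lemma sim_matching (I J : wotype) (i : I) (j : J) :
  sim i j -> matching (before i) (before j).
Proof. by case. Qed.

Lemma sim_sym (I J : wotype) (i : I) (j : J) : sim i j -> sim j i.
Proof.
elim/(well_founded_ind (@wolt_wf I)) : i j => i IH j [h1 h2].
split=> [j' /h2|i' i'i]; first by move=> [i' i'i /(IH _ i'i)]; exists i'.
by have [j' j'j /(IH _ i'i)] := h1 _ i'i; exists j'.
Qed.

Lemma matching_sym (I J : wotype) (D : set I) (E : set J) :
  matching D E -> matching E D.
Proof.
by move=> [h1 h2]; split=> [j /h2|i /h1] [k kD /sim_sym]; exists k.
Qed.

(** If k < j, then [k] is similar to some i' < i, and [i'] is similar to some l < k; by induction l
    = k, a contradiction. *)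
Lemma sim_uniq (I J : wotype) (i : I) (j k : J) : sim i j -> sim i k -> j = k.
Proof.
elim/(well_founded_ind (@wolt_wf I)) : i j k => i IH.
suff nlt (j k : J) : sim i j -> sim i k -> ~ wolt k j.
  by move=> j k ij ik; have [//|/(nlt _ _ ik ij)|/(nlt _ _ ij ik)] := wolt_total j k.
move=> [_ h] [h' _] /h[i' i'i i'k]; have [l lk i'l] := h' _ i'i.
by case: lk => _; apply; exact: IH i'i _ _ i'l i'k.
Qed.

Lemma matching_last (I J : wotype) (D : set I) (E : set J) i : matching D E ->
  is_last D i -> exists2 j, is_last E j & sim i j.
Proof.
move=> [h1 h2] [/h1[j Ej ij] Di]; exists j => //; split=> // k /h2[i' Di' i'k].
have [ii'|i'i] := wole_eq_lt (Di _ Di').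
  by rewrite -ii' in ij; rewrite (sim_uniq i'k ij); exact: wole_refl.
by case: ij => /(_ _ i'i)[l [lj _] /(sim_uniq i'k)->].
Qed.

Lemma is_last_uniq (I : wotype) (D : set I) i j :
  is_last D i -> is_last D j -> i = j.
Proof. by move=> [Di hi] [Dj hj]; apply: wole_anti; [exact: hj|exact: hi]. Qed.

(** Comparability of ordinals: either [i] has a partner in [J], or [J] is exhausted at some stage
    not after [i]. *)
Lemma sim_total (I J : wotype) (i : I) : (exists j : J, sim i j) \/
  exists2 k, k = i \/ wolt k i & matching (before k) [set: J].
Proof.
elim/(well_founded_ind (@wolt_wf I)) : i => i IH.
have [[i' [i'i [k ki' kJ]]]|no] := pselect (exists i', wolt i' i /\
    exists2 k, k = i' \/ wolt k i' & matching (before k) [set: J]).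
  right; exists k => //; right.
  by case: ki' => [->//|/wolt_trans]; exact.
have sJ i' : wolt i' i -> exists j : J, sim i' j.
  by move=> i'i; have [//|h] := IH _ i'i; case: no; exists i'.
pose S := [set j : J | exists2 i', wolt i' i & sim i' j].
have [ST|/existsNP[j0 nSj0]] := pselect (forall j, S j).
  right; exists i; first by left.
  by split=> [i' /sJ[j i'j]|j _]; [exists j|exact: ST].
(* The least unmatched [j] is the partner of [i]: all below it is matched by minimality, and an i' <
   i matched beyond [j] would have a predecessor matched with [j]. *)
have [j [nSj minj]] := @wo_min J (~` S) j0 nSj0.
left; exists j; split=> [i' i'i|k kj].
  have [k i'k] := sJ _ i'i; exists k => //.
  have [jk|kj|//] := wolt_total j k.
    by case: nSj; exists i' => //; rewrite jk.
  exfalso; apply: nSj; case: (i'k) => _ /(_ _ kj)[l li' lj].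
  by exists l => //; exact: wolt_trans li' i'i.
apply: contrapT => nSk; apply: (wolt_asym kj); exact: minj.
Qed.

(** * Independence of the process from the well-order that indexes it *)

Section ProcessInvariance.
Variables (R : realType) (M : nonstandard_model R) (prec : rel (hreal M)).

(** Each case distinction in [state_after] depends only on the order type of the segment and on the
    earlier states, which agree at similar indices. *)
Lemma state_after_matching (I J : wotype) (D : set I) (E : set J) :
  matching D E ->
  (forall (i : I) (j : J), D i -> sim i j -> state prec i = state prec j) ->
  state_after prec D (state prec (I := I)) =
  state_after prec E (state prec (I := J)).
Proof.
move=> DE ss; have [h1 h2] := DE; apply/funext => x; rewrite /state_after.
have -> : running D (state prec (I := I)) x = running E (state prec (I := J)) x.
  apply/propext; split=> r.
    by move=> j /h2[i Di ij]; rewrite -(ss _ _ Di ij); exact: r.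
  by move=> i Di; have [j Ej ij] := h1 _ Di; rewrite (ss _ _ Di ij); exact: r.
have -> : same_data prec D (state prec (I := I)) x =
    same_data prec E (state prec (I := J)) x.
  apply/funext => y; apply/propext; split=> r.
    by move=> j /h2[i Di ij]; rewrite -(ss _ _ Di ij); exact: r.
  by move=> i Di; have [j Ej ij] := h1 _ Di; rewrite (ss _ _ Di ij); exact: r.
have -> : (D = set0) = (E = set0).
  apply/propext; split=> /seteqP[s _]; apply/seteqP; split=> //.
    by move=> j /h2[i /s].
  by move=> i /h1[j /s].
case: pselect => // _; case: pselect => // _.
case: pselect => [e|ne]; case: pselect => [e'|ne'] //.
- case: (cid e) (cid e') => i li [j lj] /=.
  have [k lk ik] := matching_last DE li.
  by rewrite (is_last_uniq lj lk) (ss _ _ (proj1 li) ik).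
- case: e => i li; case: ne'.
  by have [j lj _] := matching_last DE li; exists j.
- case: e' => j lj; case: ne.
  by have [i li _] := matching_last (matching_sym DE) lj; exists i.
Qed.

Lemma state_sim (I J : wotype) (i : I) (j : J) :
  sim i j -> state prec i = state prec j.
Proof.
elim/(well_founded_ind (@wolt_wf I)) : i j => i IH j ij.
rewrite !stateE; apply: state_after_matching; first exact: sim_matching.
by move=> i' j' i'i; exact: IH.
Qed.

End ProcessInvariance.

(** * The process *)

Section SaturatedIntervals.
Variables (R : realType) (M : nonstandard_model R).
Local Notation hreal := (hreal M).

(** The free variable ranges over all of [M], hence the first conjunct. *)
Definition FBetween (lo hi : hreal) : formula R M unit :=
  FAnd (FIn R (Var M tt) (Cst unit (star M (slev R 0))))
    (FAnd (FRel (star M) (fun r s => r < s) (Cst unit (sval lo)) (Var M tt))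
          (FRel (star M) (fun r s => r < s) (Var M tt) (Cst unit (sval hi)))).

Lemma holds_FBetween (u : M) (lo hi : hreal) :
  holds_at u (FBetween lo hi) <-> exists2 y : hreal, u = sval y & lo < y < hi.
Proof.
have FRelP v (s t : term M unit) : sat (@nsmem R M) (star M) id (fun=> v)
    (FRel (star M) (fun r s => r < s) s t) <->
    rel_in (@nsmem R M) (star M) (fun r s => r < s)
      (eval id (fun=> v) s) (eval id (fun=> v) t).
  exact: sat_FRel.
split=> [[hu [h1 h2]]|[y -> /andP[h1 h2]]].
  pose y : hreal := exist (fun u : M => nsmem u (star M (slev R 0))) u hu.
  exists y => //; apply/andP; split; apply/hltE.
    exact: (proj1 (FRelP _ (Cst unit (sval lo)) (Var M tt)) h1).
  exact: (proj1 (FRelP _ (Var M tt) (Cst unit (sval hi))) h2).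
split; first exact: (svalP y).
split.
  by apply: (proj2 (FRelP _ (Cst unit (sval lo)) (Var M tt))); exact/hltE.
by apply: (proj2 (FRelP _ (Var M tt) (Cst unit (sval hi)))); exact/hltE.
Qed.

(** Passes from the cardinal bounding the length of the sequence, that of the hyperreals, to the
    cardinal of saturation, that of [M]. *)
Lemma hreal_card_le : [set: hreal] #<= [set: M].
Proof.
have /card_eqPle[_ h] : (fun x : hreal => sval x) @` [set: hreal] #= [set: hreal].
  by apply: inj_card_eq => x y _ _; exact: hreal_inj.
exact: card_le_trans h (card_leT _).
Qed.

Lemma saturated_intervals (J : Type) (D : set J) (lo hi : J -> hreal) :
  saturated M -> card_lt [set: J] [set: hreal] ->
  (forall s : seq J, (forall j, List.In j s -> D j) ->
     exists y, forall j, List.In j s -> lo j < y < hi j) ->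
  exists x, forall j, D j -> lo j < x < hi j.
Proof.
move=> satM [J_le J_nge] fin.
(* An index is needed to know that the element found in [M] is a hyperreal. *)
have [[j0 Dj0]|D0] := pselect (exists j, D j); last first.
  by exists 0 => j Dj; case: D0; exists j.
pose F := (fun j => FBetween (lo j) (hi j)) @` D.
have FJ : F #<= [set: J] := card_le_trans (card_image_le _ _) (card_leT _).
have F_lt : card_lt F [set: M].
  split; first exact: card_le_trans (card_le_trans FJ J_le) hreal_card_le.
  by move=> MF; apply: J_nge; exact: card_le_trans (card_le_trans hreal_card_le MF) FJ.
have [|u hu] := satM F F_lt.
  move=> G GF Gfin.
  (* Each formula of the finite set [G] is traced back to one index, by induction on a list
     enumerating [G]. *)
  have [s [sD sG]] : exists s : seq J, (forall j, List.In j s -> D j) /\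
      forall f, G f -> exists2 j, List.In j s & f = FBetween (lo j) (hi j).
    have [t tG] := proj1 (@finite_seqP {classic (formula R M unit)} G) Gfin.
    have : forall f : {classic (formula R M unit)}, f \in t -> F f.
      by move=> f ft; apply: GF; rewrite tG.
    have : forall f, G f -> (f : {classic (formula R M unit)}) \in t.
      by move=> f; rewrite tG.
    elim: t G {GF Gfin tG} => [|f t IH] G Gt tF.
      by exists [::]; split=> // f /Gt.
    have [|g gt|s [sD sG]] := IH [set g | (g : {classic _}) \in t] => //.
      by apply: tF; rewrite inE gt orbT.
    have [j Dj jf] : F f by apply: tF; rewrite mem_head.
    exists (j :: s); split=> [k [<-//|/sD//]|g /Gt].
    rewrite inE => /orP[/eqP ->|/sG[k ks ->]]; first by exists j => //; left.
    by exists k => //; right.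
  have [y hy] := fin s sD; exists (sval y) => f /sG[j js ->].
  by apply/holds_FBetween; exists y => //; exact: hy.
have Fj j : D j -> exists2 y : hreal, u = sval y & lo j < y < hi j.
  by move=> Dj; apply/holds_FBetween/hu; exists j.
have [x ux _] := Fj _ Dj0; exists x => j /Fj[y uy].
by have -> : x = y by apply: hreal_inj; rewrite -ux -uy.
Qed.

End SaturatedIntervals.

(** * Partial sums along the prescribed sequence *)

Section SpectralProcess.
Variables (R : realType) (M : nonstandard_model R).
Variables (prec : rel (hreal M)) (I : wotype) (c : I -> R) (lambda : I -> Lambda M).
Hypothesis prec_wo : well_order prec.
Hypothesis M_saturated : saturated M.
Hypothesis I_lt : card_lt [set: I] [set: hreal M].
Hypothesis c_neq0 : forall i, c i <> 0.
Hypothesis lambda_decr : forall i j, wolt i j -> Lambda_lt (lambda j) (lambda i).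
Local Notation hreal := (hreal M).
Local Notation h := (hinj M).
Local Notation state := (state prec (I := I)).
Local Notation A i := (mag prec (lambda i)).
Implicit Types (x y z b : hreal) (i j k : I) (D : set I).

Definition follows D : set hreal := [set y | forall i, D i ->
  exists2 u, state i y = Some u &
    [/\ u != 0, cls u = sval (lambda i) & coef prec u = c i]].

(* [b] is the sum of the terms [c j * A j] over [j < i]. *)
Definition partial_sum i b : Prop :=
  follows (before i) b /\
  forall y, follows (before i) y -> state i y = Some (y - b).

Let cn0 i : c i != 0. Proof. exact/eqP. Qed.

Let A_neq0 i : A i != 0. Proof. by case: (mag_spec prec_wo (lambda i)). Qed.

Lemma A_negl i j : wolt i j -> negl h (A j) (A i).
Proof. by move=> /lambda_decr; exact: mag_lt. Qed.

Lemma follows_running D y : follows D y -> running D state y.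
Proof. by move=> Dy i /Dy[u ys [/eqP u0 _ _]]; exists u. Qed.

(** Makes the element subtracted at a limit the same for every [y] with the prescribed data. *)
Lemma same_data_follows D y : follows D y -> same_data prec D state y = follows D.
Proof.
move=> Dy; apply/seteqP; split=> z zD i Di; have [u yu [u0 ul uc]] := Dy _ Di.
  have [u' [v [[yu' _] [zv /eqP v0] cuv luv]]] := zD _ Di.
  move: yu'; rewrite yu => -[uu']; subst u'.
  exists v; first exact: zv.
  by split; [exact: v0|exact: etrans (esym luv) ul|exact: etrans (esym cuv) uc].
have [v zv [v0 vl vc]] := zD _ Di; exists u, v.
split; [|..|exact: etrans uc (esym vc)|exact: etrans ul (esym vl)].
  by split; [exact: yu|exact/eqP].
by split; [exact: zv|exact/eqP].
Qed.

Section Step.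
Variables (D : set I) (b : I -> hreal).
Hypothesis D_initial : forall i j, wolt i j -> D j -> D i.
Hypothesis b_sum : forall i, D i -> partial_sum i (b i).

(** Replaces the recursion by inequalities. Data correct below [i] make the state at [i] equal to
    [y - b i]; [coef_close] and, by induction along [D], [negl_coef] then translate the condition at
    [i]. *)
Lemma followsP y : follows D y <->
  forall i, D i -> negl h (y - b i - h (c i) * A i) (A i).
Proof.
split=> [Dy i Di|Dy i].
  have [u yu [u0 ul uc]] := Dy i Di.
  have [_ bi] := b_sum Di.
  have : state i y = Some (y - b i).
    by apply: bi => j ji; apply: Dy; exact: D_initial ji Di.
  by rewrite yu => -[yb]; rewrite -yb -uc; exact: coef_close.
elim/(well_founded_ind (@wolt_wf I)) : i => i IH Di.
exists (y - b i).
  apply: (proj2 (b_sum Di)) => j ji; apply: (IH j ji); exact: D_initial ji Di.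
exact: (negl_coef prec_wo (cn0 i) (Dy i Di)).
Qed.

End Step.

Lemma before_initial i j k : wolt j k -> before i k -> before i j.
Proof. exact: wolt_trans. Qed.

Section NextStep.
Variables (D : set I) (b : I -> hreal).
Hypothesis D_initial : forall i j, wolt i j -> D j -> D i.
Hypothesis b_sum : forall i, D i -> partial_sum i (b i).

Let b_before m i : D m -> wolt i m -> partial_sum i (b i).
Proof. by move=> Dm im; apply: b_sum; exact: D_initial im Dm. Qed.

(** The new term makes the remainder at [m] exactly zero, and at an earlier [i] it is negligible
    against [A i]. *)
Lemma succ_follows m i : D m -> wole i m ->
  negl h (b m + h (c m) * A m - b i - h (c i) * A i) (A i).
Proof.
move=> Dm /wole_eq_lt[->|im].
  rewrite -addrA -opprD subrr; exact: negl0 (ltr_hinj M) _ (A_neq0 m).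
apply: (negl_shift (h := h)); last exact: (neglZ (ltr_hinj M) _ (A_negl im)).
have [bm _] := b_sum Dm.
exact: (proj1 (followsP (@before_initial m) (fun i => b_before Dm) (b m)) bm i im).
Qed.

Lemma limit_follows : (forall m, ~ is_last D m) -> exists x, follows D x.
Proof.
(* One inequality per index keeps the number of formulas below the saturation
   cardinal without any cardinal arithmetic. *)
move=> nlast; pose q i := h (`|c i| + 1) * `|A i|.
have [[i0 Di0]|D0] := pselect (exists i, D i); last first.
  by exists 0 => i Di; case: D0; exists i.
have [s sD|x xD] := @saturated_intervals R M I D (fun i => b i - q i)
    (fun i => b i + q i) M_saturated I_lt.
  have [m Dm sm] := seq_bound Di0 sD.
  exists (b m + h (c m) * A m) => i /sm im; rewrite -ltr_distl.
  exact: (negl_subZ_lt (ltr_hinj M) (succ_follows Dm im)).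
exists x; apply/(followsP D_initial b_sum) => i Di.
(* The interval at [i] alone only gives x - b_i = O(A_i). A later [k] gives x - b_k = O(A_k), which
   is o(A_i), and [b k] already has the right data at [i]. *)
have [k Dk ik] : exists2 k, D k & wolt i k.
  apply: contrapT => nk; apply: (nlast i); split=> // k Dk.
  by have [//|ik] := wole_or_lt k i; case: nk; exists k.
have := xD _ Dk; rewrite -ltr_distl => xk.
apply: (negl_near (ltr_hinj M) xk (A_negl ik)).
have [bk _] := b_sum Dk.
exact: (proj1 (followsP (@before_initial k) (fun i => b_before Dk) (b k)) bk i ik).
Qed.

(** The cases are those of [state_after]: empty, successor, limit. An initial segment [D] replaces
    the index so that the whole sequence is covered as well. *)
Lemma next_sum : exists2 x, follows D x &
  forall y, follows D y -> state_after prec D state y = Some (y - x).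
Proof.
have [D0|D0] := pselect (D = set0).
  exists 0 => [i|y Dy]; first by rewrite D0.
  rewrite /state_after subr0; case: pselect => [_|/(_ (follows_running Dy))//].
  by case: pselect.
have [[m lm]|nl] := pselect (exists m, is_last D m).
  have Dm := proj1 lm; exists (b m + h (c m) * A m).
    apply/(followsP D_initial b_sum) => i Di; apply: succ_follows => //.
    exact: (proj2 lm).
  move=> y Dy; rewrite /state_after.
  case: pselect => [_|/(_ (follows_running Dy))//].
  case: pselect => // _; case: pselect => [e|[]]; last by exists m.
  case: (cid e) => m' lm' /=; rewrite (is_last_uniq lm' lm).
  have [u yu [u0 ul uc]] := Dy _ Dm.
  have : state m y = Some (y - b m).
    by apply: (proj2 (b_sum Dm)) => j jm; apply: Dy; exact: D_initial jm Dm.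
  rewrite yu => -[uE]; apply: (congr1 Some).
  by rewrite /next_state uc ul hsubE hmulE -/(mag prec (lambda m)) uE opprD addrA.
have [x0 Dx0] : exists x, follows D x.
  by apply: limit_follows => m lm; apply: nl; exists m.
(* An arbitrary follower would not do: [x] has to be the element that the process itself
   subtracts. *)
exists (prec_min prec (follows D)); first exact: prec_min_in Dx0.
move=> y Dy; rewrite /state_after.
case: pselect => [_|/(_ (follows_running Dy))//].
case: pselect => // _; case: pselect => // _.
by rewrite hsubE; have -> : [set z | same_data prec D state y z] = follows D
  by exact: same_data_follows.
Qed.

End NextStep.

Lemma partial_sum_exists i : exists b, partial_sum i b.
Proof.
elim/(well_founded_ind (@wolt_wf I)) : i => i IH.
pose b j := xget 0 [set b | partial_sum j b].
have b_sum j : before i j -> partial_sum j (b j).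
  move=> /IH[bj hbj]; rewrite /b; case: xgetP => [? _ //|/(_ bj)].
  by case.
have [x ix xi] := next_sum (@before_initial i) b_sum.
by exists x; split=> // y iy; rewrite stateE xi.
Qed.

Lemma spectral_sum : exists2 x, follows setT x & stops_at prec I x.
Proof.
pose b j := xget 0 [set b | partial_sum j b].
have b_sum j : setT j -> partial_sum j (b j).
  have [bj hbj] := partial_sum_exists j.
  by rewrite /b => _; case: xgetP => [? _ //|/(_ bj)].
have [//|x xT xs] := @next_sum setT b _ b_sum.
(* Since [x] itself has the prescribed data, its state after the whole sequence is x - x = 0. *)
by exists x => //; rewrite /stops_at xs // subrr.
Qed.

(** [spectral_fun] may read the coefficient along any well-order [J], so the stage [j] found there
    is compared with the stages of [I]. *)
Lemma follows_spectral_fun x i : follows setT x -> stops_at prec I x ->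
  spectral_fun prec x (lambda i) = c i.
Proof.
move=> xT xs; have [u xu [/eqP u0 ul uc]] := xT i Logic.I.
rewrite /spectral_fun; case: xgetP => [r _|/(_ (c i))]; last first.
  by case; exists I, i, u.
move=> [J [j [v [xv v0 vl <-]]]].
have [[k jk]|[k kj kI]] := sim_total I j.
  have [w xw [_ wl wc]] := xT k Logic.I.
  have wv : w = v by move: xv; rewrite (state_sim prec jk) xw => -[].
  subst w; rewrite wc; congr c.
  have ll : lambda k = lambda i.
    apply: contrapT => nl.
    have : sval (lambda k) = sval (lambda i) by rewrite -wl -vl.
    case: (lambda k) (lambda i) nl => [l hl] [l' hl'] /= nl ll; subst l'.
    by apply: nl; congr exist; exact: Prop_irrelevance.
  (* A strictly decreasing sequence takes each class at only one index. *)
  by have [//|/lambda_decr[]|/lambda_decr[]] := wolt_total k i; rewrite ll.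
(* Here [j] lies at or beyond the order type of [I], where the process has reached 0: the state at
   [j] is 0 or [None], against the choice of [v]. *)
have xk : Defs.state prec k x = Some (h 0).
  rewrite stateE (state_after_matching kI) // => k' i' _.
  exact: state_sim.
case: kj => [kj|kj]; first by case: v0; move: xv; rewrite -kj xk => -[].
move: xv; rewrite stateE /state_after.
case: pselect => [/(_ _ kj)[w]|_ xv]; last by discriminate xv.
move=> kw nw _.
have e := etrans (esym xk) kw.
case: nw.
by case: e.
Qed.

End SpectralProcess.

Theorem theorem5p1 (R : realType) (M : nonstandard_model R)
    (M_saturated : saturated M)
    (prec : rel (hreal M)) (prec_wo : well_order prec)
    (prec_initial : initial_order prec)
    (alpha : wotype) (alpha_lt : card_lt [set: alpha] [set: hreal M])
    (c : alpha -> R) (c_neq0 : forall i, c i <> 0)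
    (lambda : alpha -> Lambda M)
    (lambda_decr : forall i j, wolt i j -> Lambda_lt (lambda j) (lambda i)) :
  exists x : hreal M, is_spectrum prec x lambda /\
    forall i, spectral_fun prec x (lambda i) = c i.
Proof.
have [x xT xs] := spectral_sum prec_wo M_saturated alpha_lt c_neq0 lambda_decr.
exists x; split; last first.
  by move=> i; exact: (follows_spectral_fun lambda_decr i xT xs).
split=> // i; have [u xu [_ ul _]] := xT i Logic.I.
by exists u.
Qed.
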